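(* Let $\aleph\geq\aleph_1$ be a cardinal. For a compact Hausdorff space $K$ the following are equivalent: (1) $K$ is an $F_\aleph$-space. (2) For every continuous affine surjection $\pi:L\to M$ between compact convex sets with $w(L)<\aleph$, and every continuous function $f:K\to M$, there exists a continuous function $g:K\to L$ such that $\pi g=f$. (3) For every continuous affine surjection $\pi:L\to M$ between compact convex sets with $w(M)<\aleph$ and $w(L)\leq\aleph$, and every continuous function $f:K\to M$, there exists a continuous function $g:K\to L$ such that $\pi g=f$. (4) For every continuous affine surjection $\pi:L\to M$ between compact convex sets with $L\in H\!L_\aleph$, and every continuous function $f:K\to M$, there exists a continuous function $g:K\to L$ such that $\pi g=f$.
   Context: $w(\cdot)$ denotes the weight of a topological space. A compact convex set means a compact convex subset of some (Hausdorff, real) locally convex space. A compact space $K$ is an $F_\aleph$-space if any two disjoint open subsets of $K$, each of which is the union of less than $\aleph$ many closed sets, have disjoint closures. $H\!L_\aleph$ is the class of compact spaces $L$ such that every open subset of $L$ is the union of less than $\aleph$ many closed subsets of $L$ (equivalently, every open cover of every subspace of $L$ has a subcover of cardinality less than $\aleph$). *)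

(* Defs.v *)
From HB Require Import structures.
From mathcomp Require Import all_boot all_order all_algebra.
From mathcomp Require Import all_classical all_reals all_analysis.

Set Implicit Arguments.
Unset Strict Implicit.
Unset Printing Implicit Defensive.

Import Order.TTheory GRing.Theory Num.Theory.

Local Open Scope classical_set_scope.
Local Open Scope card_scope.
Local Open Scope ring_scope.
Local Open Scope convex_scope.

(** A cardinal number is represented by a type [A], standing for the
    cardinality of [[set: A]]. *)

Definition card_lt T U (A : set T) (B : set U) : Prop :=
  A #<= B /\ ~ (B #<= A).

(** Any nonempty family of sets has a member of least cardinality: take, by
    Zorn's lemma, a maximal set [Z] of choice functions for the family on which
    every evaluation map is injective; some evaluation map is then onto. *)
Lemma exists_min_card (U : Type) (D : set (set U)) :
  D !=set0 -> exists2 B, D B & forall C, D C -> B #<= C.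
Proof.
move=> [B0 DB0].
pose P (Z : set (set U -> U)) :=
  (forall f, Z f -> forall B, D B -> B (f B)) /\
  (forall f g B, Z f -> Z g -> D B -> f B = g B -> f = g).
have [Z [[Zch Zinj] Zmax]] : exists Z, P Z /\ forall Y, Z `<` Y -> ~ P Y.
  apply: Zorn_bigcup => F FP Ftot; split.
    by move=> f [Y FY Yf]; exact: (FP _ FY).1.
  move=> f g B [Y FY Yf] [Y' FY' Yg] DB.
  case: (Ftot _ _ FY FY') => YY'.
    by apply: (FP _ FY').2 => //; exact: YY'.
  by apply: (FP _ FY).2 => //; exact: YY'.
have evalK B : D B -> set_inj Z (fun f : set U -> U => f B).
  by move=> DB f g /set_mem Zf /set_mem Zg; exact: Zinj.
have [[B DB sB]|noB] :=
    pselect (exists2 B, D B & B `<=` [set f B | f in Z]).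
  exists B => // C DC.
  have BZ : B #<= [set f B | f in Z] by exact: subset_card_le.
  apply: (card_le_trans BZ); apply: (card_le_trans (card_image_le _ _)).
  rewrite -(card_le_eql (inj_card_eq (evalK C DC))).
  by apply: subset_card_le => _ [f Zf <-]; exact: (Zch f Zf C DC).
exfalso.
have new B : D B -> exists x, B x /\ ~ [set f B | f in Z] x.
  move=> DB; apply: contrapT => nx; apply: noB; exists B => // x Bx.
  by apply: contrapT => ?; apply: nx; exists x.
have [x0 _] := new _ DB0.
have /choice[h hP] : forall B, exists x, D B -> B x /\ ~ [set f B | f in Z] x.
  move=> B; have [/new[x ?]|nDB] := pselect (D B); first by exists x.
  by exists x0.
apply: (Zmax (Z `|` [set h])).
  split; first by move=> f ?; left.
  move=> /(_ h (or_intror erefl)) Zh.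
  by case: (hP _ DB0) => _; apply; exists h.
split.
  by move=> f [Zf|->] B DB; [exact: (Zch f Zf B DB)|exact: (hP B DB).1].
move=> f g B [Zf|->] [Zg|->] DB //; first exact: Zinj.
  by move=> fg; case: (hP _ DB) => _ []; exists f.
by move=> gf; case: (hP _ DB) => _ []; exists g.
Qed.

(** [weight T] is a base of least cardinality, so that [w(T)] is the
    cardinality of the set [weight T]. *)
Definition weight (T : topologicalType) : set (set T) :=
  xget set0 [set B | basis B /\ forall C : set (set T), basis C -> B #<= C].
Arguments weight : clear implicits.

Lemma weightP (T : topologicalType) :
  basis (weight T) /\ forall C : set (set T), basis C -> weight T #<= C.
Proof.
rewrite /weight; case: xgetP => [B _ //|noB]; exfalso.
have [|B bB minB] := @exists_min_card (set T) [set B | basis B].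
  exists open; split => // x A; rewrite nbhsE => -[B [oB Bx] BA].
  by exists B.
exact: (noB B).
Qed.

Lemma weight_ltP (T : topologicalType) (A : Type) :
  card_lt (weight T) [set: A] <->
  exists2 B : set (set T), basis B & card_lt B [set: A].
Proof.
have [bw wmin] := weightP T; split=> [wA|[B bB [BA nAB]]].
  by exists (weight T).
split; first exact: card_le_trans (wmin _ bB) BA.
by move=> Aw; apply: nAB; exact: card_le_trans Aw (wmin _ bB).
Qed.

Definition lt_union_closed (A : Type) (T : topologicalType) (U : set T) : Prop :=
  exists2 F : set (set T), card_lt F [set: A] &
    (forall C, F C -> closed C) /\ U = \bigcup_(C in F) C.

Definition F_space (A : Type) (T : topologicalType) : Prop :=
  compact [set: T] /\
  forall U V : set T, open U -> open V -> U `&` V = set0 ->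
    lt_union_closed A U -> lt_union_closed A V ->
    closure U `&` closure V = set0.

Definition HL_space (A : Type) (T : topologicalType) : Prop :=
  compact [set: T] /\ forall U : set T, open U -> lt_union_closed A U.

(** [tvsType] is the library's class of locally convex spaces; it does not
    include the Hausdorff axiom. *)
Definition compact_convex (R : realType) (E : tvsType R) (L : set E) : Prop :=
  [/\ hausdorff_space E, compact L & convex_set L].

Definition affine_on (R : realType) (E F : tvsType R) (L : set E)
    (p : E -> F) : Prop :=
  forall (x y : convex_lmodType E) (t : {i01 R}), L x -> L y ->
    p (x <| t |> y) = (p x : convex_lmodType F) <| t |> p y.

(** Maps out of and into compact convex sets are represented by total maps of
    the ambient spaces, of which only the values on the domain matter. *)
Definition affine_surjection (R : realType) (E F : tvsType R)
    (L : set E) (M : set F) (p : E -> F) : Prop :=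
  [/\ {within L, continuous p}, affine_on L p & p @` L = M].

(** Lifting of continuous maps from [K] through the continuous affine
    surjections between pairs of compact convex sets satisfying [P]. *)
Definition lifts_through (R : realType) (K : topologicalType)
    (P : forall E F : tvsType R, set E -> set F -> Prop) : Prop :=
  forall (E F : tvsType R) (L : set E) (M : set F),
    compact_convex L -> compact_convex M -> P E F L M ->
  forall p : E -> F, affine_surjection L M p ->
  forall f : K -> F, continuous f -> range f `<=` M ->
  exists g : K -> E, [/\ continuous g, range g `<=` L & p \o g = f].

(* Main.v *)
Require Import Defs.
From HB Require Import structures.
From mathcomp Require Import all_boot all_order all_algebra.
From mathcomp Require Import all_classical all_reals all_analysis.
From mathcomp Require Import wochoice ring lra.

Set Implicit Arguments.
Unset Strict Implicit.
Unset Printing Implicit Defensive.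

Import Order.TTheory GRing.Theory Num.Theory.
Import numFieldNormedType.Exports.

Local Open Scope classical_set_scope.
Local Open Scope card_scope.
Local Open Scope ring_scope.

(** If (1) holds, embed [L] in a product of lines by continuous linear forms
    separating its points (Hahn-Banach), well-order the forms, and lift [f] one
    coordinate at a time, taking limits by compactness.  At each step the points
    of [L] with the prescribed earlier coordinates over [f x] form a compact
    convex set, on which the next form takes an interval of values
    [[u x, v x]]; the sets [{v < r}] and [{u > r}] are disjoint open unions of
    fewer than [A] closed sets, so their closures are disjoint, and this is what
    a Tietze-like iteration needs to insert a continuous function between [u]
    and [v].  For (3), [A] is well-ordered so that every proper initial segment
    is smaller than [A]: the space cut out by [M] and the coordinates of an
    initial segment then has fewer than [A] separating closed sets.

    Conversely, let [U] and [V] be disjoint open unions of fewer than [A] closed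
    sets [C] and [D].  Urysohn functions [u_C] and [v_D] form a map into the
    projection [M] of [L = {(s, t, r) | s_C <= r, t_D <= 1 - r}] along [r]; the
    last coordinate of a lift is [1] on [U] and [0] on [V]. *)

(** * Cardinal arithmetic *)

Lemma inj_fun_card_le T U (X : set T) (Y : set U) (f : T -> U) :
  set_fun X Y f -> set_inj X f -> X #<= Y.
Proof.
by move=> fXY fI; have /injfunPex[g] := ex_intro2 _ _ f fXY fI; exact: inj_card_le.
Qed.

Lemma card_le_inj_fun T U (X : set T) (Y : set U) : Y !=set0 ->
  X #<= Y -> exists2 f : T -> U, set_fun X Y f & set_inj X f.
Proof.
move=> [y0 Yy0]; case/card_leP => f.
exists (fun x => if pselect (X x) is left Xx then
          val (f (SigSub (mem_set Xx))) else y0).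
  by move=> x Xx /=; case: pselect => // ?; exact: set_valP.
move=> x x' /set_mem Xx /set_mem Xx'; case: pselect => // p; case: pselect => // p'.
by move/val_inj/(@inj _ _ _ f) => /(_ (mem_set I) (mem_set I)) [].
Qed.

(** Disjoint copies of [X] and [Y] in [T + U] form a two-member family, and [exists_min_card] picks
    the smaller member. *)
Lemma card_le_total T U (X : set T) (Y : set U) : X #<= Y \/ Y #<= X.
Proof.
pose D := [set B : set (T + U) | B = inl @` X \/ B = inr @` Y].
have [|B DB minB] := @exists_min_card _ D; first by exists (inl @` X); left.
have eX : (@inl T U) @` X #= X by apply: inj_card_eq => ? ? _ _ [].
have eY : (@inr T U) @` Y #= Y by apply: inj_card_eq => ? ? _ _ [].
have [lX lY] := (minB _ (or_introl erefl), minB _ (or_intror erefl)).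
rewrite (card_le_eqr eX) in lX; rewrite (card_le_eqr eY) in lY.
by case: DB => eB; rewrite eB ?(card_le_eql eX) ?(card_le_eql eY) in lX lY;
  [left|right].
Qed.

(** Finite sequences over [X] carry the cardinal arithmetic: pairs, unions and finite intersections
    are all coded by them. *)
Definition allin T (X : set T) (s : seq T) : Prop := all (fun x => `[<X x>]) s.

Lemma allin_cons T (X : set T) x s : allin X (x :: s) <-> X x /\ allin X s.
Proof.
by rewrite /allin /=; split=> [/andP[/asboolP]|[? ?]] //; apply/andP; split => //;
  exact/asboolP.
Qed.

Lemma allin_cat T (X : set T) s s' : allin X (s ++ s') <-> allin X s /\ allin X s'.
Proof. by rewrite /allin all_cat; split=> /andP. Qed.

Lemma sub_allin T (X Y : set T) s : X `<=` Y -> allin X s -> allin Y s.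
Proof. by move=> XY; apply: sub_all => x /asboolP ?; exact/asboolP/XY. Qed.

(* An entry outside [D] is sent into [D] by [r] and marked by [d1] instead of [d0]. *)
Lemma recode_seq T (D X : set T) (d0 d1 : T) (r : T -> T) :
  D d0 -> D d1 -> d0 <> d1 ->
  (forall x, X x -> ~ D x -> D (r x)) ->
  (forall x y, X x -> ~ D x -> X y -> ~ D y -> r x = r y -> x = y) ->
  exists2 enc : seq T -> seq T, forall s, allin X s -> allin D (enc s) &
    forall s s', allin X s -> allin X s' -> enc s = enc s' -> s = s'.
Proof.
move=> Dd0 Dd1 d01 rD rI.
pose code x := if pselect (D x) then (d0, x) else (d1, r x).
pose enc s := foldr (fun x t => (code x).1 :: (code x).2 :: t) [::] s.
exists enc.
  elim=> // x s IH /allin_cons [Xx /IH Ds] /=.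
  apply/allin_cons; rewrite allin_cons /code; case: pselect => //= nDx.
  by split => //; split=> //; exact: rD.
elim=> [|x s IH] [|x' s'] //= /allin_cons[Xx Xs] /allin_cons[Xx' Xs'] [e1 e2 e3].
congr (_ :: _); last exact: IH.
move: e1 e2; rewrite /code; case: pselect => nx; case: pselect => nx' //=.
- by move=> e; case: d01.
- by move=> _; exact: rI.
Qed.

(* By Zorn's lemma there is a maximal [D] with an injection of [seq D] into [D];
   recoding would extend it to a disjoint copy of [D], so [~` D] is the smaller
   part and all of [seq T] can be recoded into [seq D]. *)
Lemma card_seq T : [set: nat] #<= [set: T] -> [set: seq T] #<= [set: T].
Proof.
move=> infT.
have [t0 _] : exists t : T, True.
  apply: contrapT => nT; move: infT; rewrite (_ : [set: T] = set0).
    by rewrite card_le0 => /eqP/seteqP[/(_ 0%N)] /(_ I).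
  by rewrite -subset0 => t _; apply: nT; exists t.
pose ok (p : set T * (seq T -> T)) :=
  (forall s, allin p.1 s -> p.1 (p.2 s)) /\
  (forall s s', allin p.1 s -> allin p.1 s' -> p.2 s = p.2 s' -> s = s').
have /card_le_inj_fun[|i _ iI] := infT; first by exists t0.
have {}iI : injective i by move=> x y; apply: iI; rewrite inE.
(* Zorn's lemma starts at a copy of [nat] inside [T], whose finite sequences are numbered by
   [pickle]. *)
have [P0 okP0] : exists p, ok p.
  pose inv t := xget 0%N [set n | i n = t].
  have invK n : inv (i n) = n.
    by rewrite /inv; case: xgetP => [m _ /= /iI//|/(_ n)] /(_ erefl).
  exists (range i, fun s => i (pickle (map inv s))); split => /=.
    by move=> s _; exists (pickle (map inv s)).
  move=> s s' rs rs' /iI /(pcan_inj pickleK).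
  elim: s s' rs rs' => [|x s IH] [|x' s'] //= /allin_cons[[n _ <-] rs].
  by move=> /allin_cons[[n' _ <-] rs'] [] /[!invK] -> /IH ->.
pose S := {p | ok p}.
pose R (p q : S) := `[< (sval p).1 `<=` (sval q).1 /\
  forall s, allin (sval p).1 s -> (sval p).2 s = (sval q).2 s >].
have [||C Ctot|[[D j] okD] maxD] := @ZL_preorder S (exist _ _ okP0) R.
- by move=> p; apply/asboolP; split.
- move=> p q r /asboolP[pq epq] /asboolP[qr eqr]; apply/asboolP; split.
    exact: subset_trans qr.
  by move=> s ps; rewrite epq// eqr//; exact: sub_allin ps.
- have [[c0 Cc0]|C0] := pselect (C !=set0); last first.
    by exists (exist _ _ okP0) => s Cs; exfalso; apply: C0; exists s.
  pose D := \bigcup_(c in C) (sval c).1.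
  have CD s : allin D s -> exists2 c, C c & allin (sval c).1 s.
    elim: s => [|x s IH]; first by exists c0.
    move=> /allin_cons[[c Cc cx] /IH[c' Cc' c's]].
    case: (Ctot _ _ Cc Cc') => /asboolP[cc' _].
      by exists c' => //; apply/allin_cons; split => //; exact: cc'.
    by exists c => //; apply/allin_cons; split => //; exact: sub_allin c's.
  have /choice[cs csP] : forall s, exists c, allin D s -> C c /\ allin (sval c).1 s.
    by move=> s; have [/CD[c]|] := pselect (allin D s); [exists c|exists c0].
  pose j s := (sval (cs s)).2 s.
  have jE c s : C c -> allin (sval c).1 s -> (sval c).2 s = j s.
    move=> Cc ccs; rewrite /j; have [|Cc' c's] := csP s.
      by apply: sub_allin ccs => x cx; exists c.
    case: (Ctot _ _ Cc Cc') => /asboolP[_ e]; first exact: e.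
    by rewrite e.
  have okj : ok (D, j).
    split => /= [s /CD[c Cc ccs]|s s' /CD[c Cc ccs] /CD[c' Cc' ccs']].
      by rewrite -(jE c)//; exists c => //; exact: (svalP c).1.
    case: (Ctot _ _ Cc Cc') => /asboolP[cc' _].
      rewrite -!(jE c')//; last exact: sub_allin ccs.
      by apply: (svalP c').2 => //; exact: sub_allin ccs.
    rewrite -!(jE c)//; last exact: sub_allin ccs'.
    by apply: (svalP c).2 => //; exact: sub_allin ccs'.
  exists (exist _ _ okj) => c Cc; apply/asboolP; split => /=.
    by move=> x cx; exists c.
  by move=> s cs_; exact: jE.
have [/= jD jI] := okD.
have Dd0 : D (j [::]) by exact: jD.
have Dd1 : D (j [:: j [::]]) by apply: jD; apply/allin_cons.
have d01 : j [::] <> j [:: j [::]].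
  by move=> /jI; move=> /(_ isT) H; have /H : allin D [:: j [::]] by exact/allin_cons.
have aT s : allin [set: T] s by elim: s => // x s ?; exact/allin_cons.
have [lt|ge] := card_le_total (~` D) D.
  have /card_le_inj_fun[|r rD rI] := lt; first by exists (j [::]).
  have [||enc encD encI] := @recode_seq T D setT _ _ r Dd0 Dd1 d01.
  - by move=> x _; exact: rD.
  - by move=> x y _ Dx _ Dy; apply: rI; exact: mem_set.
    apply: (@inj_fun_card_le _ _ _ _ (fun s => j (enc s))) => // s s' _ _ /jI ee.
  by apply: encI => //; apply: ee; exact: encD.
have [nD0|D0] := pselect (~` D !=set0); last first.
  have DT : D = setT.
    by apply/seteqP; split => // x _; apply: contrapT => Dx; apply: D0; exists x.
  subst D.
  by apply: (@inj_fun_card_le _ _ _ _ j) => // s s' _ _; exact: jI.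
have [e eD eI] := card_le_inj_fun nD0 ge.
pose X := D `|` e @` D.
have /choice[r rP] : forall x, exists y, X x -> ~ D x -> D y /\ e y = x.
  move=> x; have [[y Dy <-]|nx] := pselect ((e @` D) x); first by exists y.
  by exists t0 => -[|/nx].
have [|x y Xx Dx Xy Dy|enc encD encI] := @recode_seq T D X _ _ r Dd0 Dd1 d01.
- by move=> x Xx /rP[].
- by move=> rxy; rewrite -(rP _ Xx Dx).2 rxy (rP _ Xy Dy).2.
(* A sequence not inside [D] is recoded into [D] and then sent by [e] outside [D], so its value
   cannot collide with a value of [j] on sequences in [D]. *)
pose j' s := if pselect (allin D s) then j s else e (j (enc s)).
have okj' : ok (X, j').
  split=> /= [s Xs|s s' Xs Xs'].
    by rewrite /j'; case: pselect => Ds; [left; exact: jD|right; exists (j (enc s)) => //; exact/jD/encD].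
  rewrite /j'; case: pselect => Ds; case: pselect => Ds' /=.
  - exact: jI.
  - by move=> ee; case: (eD _ (jD _ (encD _ Xs'))); rewrite -ee; exact: jD.
  - by move=> ee; case: (eD _ (jD _ (encD _ Xs))); rewrite ee; exact: jD.
  - move=> /eI ee; apply: encI => //; apply: jI; [exact: encD|exact: encD|].
    by apply: ee; apply: mem_set; exact/jD/encD.
have /asboolP[/= XD _] : R (exist _ _ okj') (exist _ (D, j) okD).
  apply: maxD; apply/asboolP; split => /=; first by move=> x; left.
  by move=> s Ds; rewrite /j'; case: pselect.
by exfalso; apply: (eD _ Dd0); apply: XD; right; exists (j [::]).
Qed.

Lemma card_le_lt T U V (X : set T) (Y : set U) (Z : set V) :
  X #<= Y -> card_lt Y Z -> card_lt X Z.
Proof.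
move=> XY [YZ nZY]; split; first exact: card_le_trans YZ.
by move=> ZX; apply: nZY; exact: card_le_trans XY.
Qed.

(** The largest of [X], [Y] and [nat], copied into [B]. Its infinity makes it absorb finite
    sequences, which bounds sums and products below [B]. *)
Lemma infinite_card_lt_ub T U B (X : set T) (Y : set U) :
  card_lt [set: nat] [set: B] -> card_lt X [set: B] -> card_lt Y [set: B] ->
  exists Z : set B, [/\ card_lt Z [set: B], infinite_set Z, X #<= Z & Y #<= Z].
Proof.
move=> Blt Xlt Ylt.
have [V [Z0 [Zlt Zinf XZ YZ]]] : exists V (Z : set V),
    [/\ card_lt Z [set: B], [set: nat] #<= Z, X #<= Z & Y #<= Z].
  have [XY|YX] := card_le_total X Y.
    have [NY|YN] := card_le_total [set: nat] Y; first by exists U, Y.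
    by exists nat, [set: nat]; split => //; exact: card_le_trans YN.
  have [NX|XN] := card_le_total [set: nat] X; first by exists T, X.
  by exists nat, [set: nat]; split => //; exact: card_le_trans XN.
have [b0 _] : [set: B] !=set0.
  apply/set0P/eqP => B0; case: Blt; rewrite B0 card_le0 => /eqP/seteqP[+ _].
  by move=> /(_ 0%N I).
have [|f _ fI] := @card_le_inj_fun _ _ _ _ _ Zlt.1; first by exists b0.
have fZ : f @` Z0 #= Z0 by exact: inj_card_eq.
exists (f @` Z0); split.
- by apply: card_le_lt Zlt; rewrite (card_le_eql fZ).
- by apply/infiniteP; rewrite (card_le_eqr fZ).
- by rewrite (card_le_eqr fZ).
- by rewrite (card_le_eqr fZ).
Qed.

Lemma card_le_seq T U (X : set T) (Z : set U) : infinite_set Z -> X #<= Z ->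
  [set s | allin X s] #<= Z.
Proof.
move=> Zinf XZ.
have ZZ : [set: set_type Z] #= Z by exact: card_setT.
have /infiniteP NZ := Zinf.
have [z0 Zz0] := infinite_setN0 Zinf.
have zT0 : [set: set_type Z] !=set0 by exists (SigSub (mem_set Zz0)).
have := XZ; rewrite -(card_le_eqr ZZ) => /(card_le_inj_fun zT0)[f _ fI].
rewrite -(card_le_eqr ZZ); apply: (@card_le_trans _ _ _ [set: seq (set_type Z)]).
  apply: (@inj_fun_card_le _ _ _ _ (map f)) => // s s' /set_mem /= Xs /set_mem /=.
  elim: s s' Xs => [|x s IH] [|x' s'] //= /allin_cons[Xx Xs] /allin_cons[Xx' Xs'].
  by move=> [/(fI _ _ (mem_set Xx) (mem_set Xx')) -> /IH ->].
by apply: card_seq; rewrite (card_le_eqr ZZ).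
Qed.

Lemma card_lt_seq B T (X : set T) : card_lt [set: nat] [set: B] ->
  card_lt X [set: B] -> card_lt [set s | allin X s] [set: B].
Proof.
move=> Blt Xlt; have [Z [Zlt Zinf XZ _]] := infinite_card_lt_ub Blt Xlt Xlt.
by apply: card_le_lt Zlt; exact: card_le_seq.
Qed.

Lemma card_le_setX T U V (X : set T) (Y : set U) (Z : set V) :
  infinite_set Z -> X #<= Z -> Y #<= Z -> X `*` Y #<= Z.
Proof.
move=> Zinf XZ YZ.
apply: card_le_trans (card_le_seq Zinf (card_lexx Z)).
have Z0 := infinite_setN0 Zinf.
have [f fZ fI] := card_le_inj_fun Z0 XZ.
have [g gZ gI] := card_le_inj_fun Z0 YZ.
apply: (@inj_fun_card_le _ _ _ _ (fun xy => [:: f xy.1; g xy.2])).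
  move=> [x y] [/= Xx Yy]; apply/allin_cons; split; first exact: fZ.
  by apply/allin_cons; split => //; exact: gZ.
move=> [x y] [x' y'] /set_mem[/= ? ?] /set_mem[/= ? ?] [e1 e2].
by congr (_, _); [apply: fI|apply: gI] => //; exact: mem_set.
Qed.

Lemma card_lt_setX B T U (X : set T) (Y : set U) : card_lt [set: nat] [set: B] ->
  card_lt X [set: B] -> card_lt Y [set: B] -> card_lt (X `*` Y) [set: B].
Proof.
move=> Blt Xlt Ylt; have [Z [Zlt Zinf XZ YZ]] := infinite_card_lt_ub Blt Xlt Ylt.
by apply: card_le_lt Zlt; exact: card_le_setX.
Qed.

(** The length of the code tells the two cases apart: points of [X] become sequences of length one,
    the other points of [Y] sequences of length two. *)
Lemma card_lt_setU B T (X Y : set T) : card_lt [set: nat] [set: B] ->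
  card_lt X [set: B] -> card_lt Y [set: B] -> card_lt (X `|` Y) [set: B].
Proof.
move=> Blt Xlt Ylt; have [Z [Zlt Zinf XZ YZ]] := infinite_card_lt_ub Blt Xlt Ylt.
apply: card_le_lt Zlt; apply: card_le_trans (card_le_seq Zinf (card_lexx Z)).
have Z0 := infinite_setN0 Zinf.
have [f fZ fI] := card_le_inj_fun Z0 XZ.
have [g gZ gI] := card_le_inj_fun Z0 YZ.
apply: (@inj_fun_card_le _ _ _ _
  (fun x => if `[<X x>] then [:: f x] else [:: g x; g x])).
  move=> x XYx /=; case: asboolP => Xx.
    by apply/(allin_cons Z); split => //; exact: fZ.
  have Zgx : Z (g x) by apply: gZ; case: XYx.
  by apply/(allin_cons Z); split => //; exact/allin_cons.
move=> x x' /set_mem XYx /set_mem XYx'.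
case: asboolP => Xx; case: asboolP => Xx' // [].
  by apply: fI; exact: mem_set.
by move=> e _; apply: gI e; apply: mem_set; [case: XYx|case: XYx'].
Qed.

Lemma card_lt_countable B T (X : set T) : card_lt [set: nat] [set: B] ->
  countable X -> card_lt X [set: B].
Proof. by move=> Blt cX; exact: card_le_lt Blt. Qed.

(** * Well-orders and their initial segments *)

Lemma well_founded_order T : exists lt : T -> T -> Prop,
  [/\ well_founded lt, forall x y z, lt x y -> lt y z -> lt x z &
      forall x y, [\/ lt x y, x = y | lt y x]].
Proof.
have [R wR] := well_ordering_principle {classic T}.
have anti x y : R x y && R y x -> x = y.
  exact: (@wo_chain_antisymmetric _ R predT (withinW wR)).
have min (P : set T) : P !=set0 -> exists2 z, P z & forall x, P x -> R z x.
  move=> [x Px]; have [|z [[zP zmin] _]] := wR [pred x | `[<P x>]].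
    by exists x; apply/asboolP; exact: Px.
  exists z; first by move/asboolP: zP.
  by move=> y Py; apply: zmin; apply/asboolP; exact: Py.
(* Totality and transitivity come from least elements of sets with two and three points. *)
have tot x y : R x y \/ R y x.
  have [|z [->|->] zm] := min [set x; y]; first by exists x; left.
  - by left; apply: zm; right.
  - by right; apply: zm; left.
have refl x : R x x by case: (tot x x).
have trans x y z : R x y -> R y z -> R x z.
  move=> xy yz; have [|w] := min [set t | [\/ t = x, t = y | t = z]].
    by exists x; constructor 1.
  case=> -> m.
  - by apply: m; constructor 3.
  - have /(conj xy)/andP/anti -> // : R y x by apply: m; constructor 1.
  - have /(conj yz)/andP/anti <- // : R z y by apply: m; constructor 2.
exists (fun x y => R x y /\ x <> y); split.
- move=> x; apply: contrapT => nx.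
  have [|z nz zm] := min [set x | ~ Acc (fun x y => R x y /\ x <> y) x].
    by exists x.
  apply: nz; constructor => y [yz ynz]; apply: contrapT => ny; apply: ynz.
  by apply: anti; rewrite yz zm.
- move=> x y z [xy nxy] [yz nyz]; split; first exact: trans yz.
  by move=> e; subst z; apply: nxy; apply: anti; rewrite xy yz.
- move=> x y; have [->|xy] := pselect (x = y); first by constructor 2.
  by case: (tot x y) => ?; [constructor 1|constructor 3; split => // /esym].
Qed.

(* Take the shortest initial segment of a well-order of [A] that is as large as [A]. *)
Lemma initial_order A : exists (W : set A) (lt : set_type W -> set_type W -> Prop),
  [/\ [set: A] #<= [set: set_type W], well_founded lt,
      forall x y z, lt x y -> lt y z -> lt x z,
      forall x y, [\/ lt x y, x = y | lt y x] &
      forall w, card_lt [set v | lt v w] [set: A]].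
Proof.
have [lt [wf trans tri]] := well_founded_order A.
have [W [AW segW]] : exists W : set A, [set: A] #<= W /\
    forall w, W w -> card_lt [set v | lt v w] [set: A].
  have [small|] := pselect (forall w, ~ ([set: A] #<= [set v | lt v w])).
    by exists setT; split => // w _; split; [exact: card_leT|exact: small].
  move=> /existsNP[w0 /contrapT]; elim/(well_founded_ind wf): w0 => w IH Aw.
  have [[v vw Av]|nv] := pselect (exists2 v, lt v w & [set: A] #<= [set u | lt u v]).
    exact: (IH v).
  exists [set v | lt v w]; split => // v vw; split; first exact: card_leT.
  by move=> Av; apply: nv; exists v.
exists W, (fun x y => lt (val x) (val y)); split.
- by rewrite (card_le_eqr (card_setT W)).
- move=> x; elim/(well_founded_ind wf): {x}(val x) {-2}x (erefl (val x)) => a IH x xa.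
  by constructor => y yx; apply: (IH (val y)) => //; rewrite -xa.
- by move=> x y z; exact: trans.
- move=> x y; case: (tri (val x) (val y)); [constructor 1|constructor 2|constructor 3] => //.
  exact: val_inj.
- move=> w; apply: card_le_lt (segW _ (set_valP w)).
  by apply: (@inj_fun_card_le _ _ _ _ val) => // x y _ _; exact: val_inj.
Qed.

(** * Insertion of a continuous function *)

Lemma geometric_lt (R : realType) (N e : R) : 0 <= N -> 0 < e ->
  exists n, (2 / 3) ^+ n * N < e.
Proof.
move=> N0 e0.
have q1 : `|2 / 3 : R| < 1 by rewrite ger0_norm; lra.
(* Dividing by [N + 1] instead of [N] covers the case [N = 0]. *)
have /cvgrPdist_lt/(_ (e / (N + 1))) := cvg_expr q1.
have eN : 0 < e / (N + 1) by rewrite divr_gt0//; lra.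
move=> /(_ eN)[n _ /(_ n (leqnn n))] /=.
rewrite sub0r normrN ger0_norm; last by apply: exprn_ge0; lra.
rewrite ltr_pdivlMr; last by lra.
move=> lt_e; exists n; apply: le_lt_trans lt_e; apply: ler_wpM2l; last by lra.
by apply: exprn_ge0; lra.
Qed.

(** Let [X] be where [k] exceeds [v] by more than [c / 3], and [Y] where it falls short of [u] by
    more than [c / 3]. Near a common closure point [z], continuity of [k] puts them inside
    [{v < k z}] and [{u > k z}], so their closures are disjoint. A Urysohn function then lowers [k]
    by [c / 3] on [X] and raises it by [c / 3] on [Y], which cuts the error from [c] to
    [2 / 3 * c]. *)
Lemma insertion_step (R : realType) (K : topologicalType) (u v k : K -> R) (c : R) :
  normal_space K -> continuous k -> 0 <= c ->
  (forall r, closure [set x | v x < r] `&` closure [set x | r < u x] = set0) ->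
  (forall x, u x - c <= k x <= v x + c) ->
  exists k', [/\ continuous k', forall x, `|k' x - k x| <= c / 3 &
    forall x, u x - 2 / 3 * c <= k' x <= v x + 2 / 3 * c].
Proof.
move=> nK ck c0 clD ukv.
have [c00|cn0] := eqVneq c 0.
  exists k; split => // x; first by rewrite subrr normr0 c00 mul0r.
  by move: (ukv x); rewrite c00 mulr0.
have cp : 0 < c by rewrite lt_neqAle eq_sym cn0.
pose X := [set x | v x < k x - c / 3]; pose Y := [set x | k x + c / 3 < u x].
have XY : closure X `&` closure Y = set0.
  rewrite -subset0 => z [Xz Yz]; rewrite -(clD (k z)).
  have nz : nbhs z [set y | `|k z - k y| < c / 3].
    by have /cvgrPdist_lt := ck z; apply; lra.
  split=> B nB.
    have [y [Xy [/= kzy By]]] := Xz _ (filterI nz nB).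
    by exists y; split => //=; move: Xy kzy; rewrite /X/= ltr_norml => ? /andP[? ?]; lra.
  have [y [Yy [/= kzy By]]] := Yz _ (filterI nz nB).
  by exists y; split => //=; move: Yy kzy; rewrite /Y/= ltr_norml => ? /andP[? ?]; lra.
have [+ _] := @normal_separatorP R K.
move=> /(_ nK _ _ (@closed_closure _ X) (@closed_closure _ Y) XY).
move=> /(@uniform_separatorP _ R)[f [cf f01 fX fY]].
have fI x : 0 <= f x <= 1 by have := f01 (f x); rewrite /= in_itv /=; apply; exists x.
exists (fun x => k x + (2 * f x - 1) * (c / 3)); split.
- move=> x; apply: cvgD; first exact: ck.
  apply: cvgM; last exact: cvg_cst.
  by apply: cvgB; [apply: cvgM; [exact: cvg_cst|exact: cf]|exact: cvg_cst].
- move=> x; rewrite addrC addKr normrM (ger0_norm (_ : 0 <= c / 3)); last by lra.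
  rewrite -[leRHS]mul1r; apply: ler_wpM2r; first by lra.
  by rewrite ler_norml; move: (fI x) => /andP[? ?]; lra.
- move=> x; move: (ukv x) (fI x) => /andP[? ?] /andP[f0 f1].
  have ? : 0 <= f x * c by rewrite mulr_ge0.
  have ? : f x * c <= c by rewrite ler_piMl.
  apply/andP; split.
    have [ux|ux] := ltP (k x + c / 3) (u x); last by nra.
    have -> : f x = 1 by apply: fY; exists x => //; exact: subset_closure.
    by lra.
  have [vx|vx] := ltP (v x) (k x - c / 3); last by nra.
  have -> : f x = 0 by apply: fX; exists x => //; exact: subset_closure.
  by lra.
Qed.

(* In the application [u] is lower and [v] upper semicontinuous, the reverse of
   the situation of the Katetov-Tong theorem: semicontinuity is of no help and
   the condition on closures replaces it. *)
Lemma insertion (R : realType) (K : topologicalType) (u v : K -> R) (N : R) :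
  normal_space K -> 0 <= N -> (forall x, u x <= N) -> (forall x, - N <= v x) ->
  (forall r, closure [set x | v x < r] `&` closure [set x | r < u x] = set0) ->
  exists k : K -> R, continuous k /\ forall x, u x <= k x <= v x.
Proof.
move=> nK N0 uN vN clD.
pose good (p : (K -> R) * R) := [/\ continuous p.1, 0 <= p.2 &
  forall x, u x - p.2 <= p.1 x <= v x + p.2].
have /choice[F FP] : forall p, exists k', good p ->
    good (k', 2 / 3 * p.2) /\ forall x, `|k' x - p.1 x| <= p.2 / 3.
  move=> [k c]; have [[ck c0 kuv]|] := pselect (good (k, c)); last by exists k.
  have [k' [ck' kk' uk'v]] := insertion_step nK ck c0 clD kuv.
  by exists k' => _; split=> //; split => //=; rewrite mulr_ge0//; lra.
(* The zero function is a first approximation with error [N], by the bounds on [u] and [v]. *)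
pose s := fix s n := if n is m.+1 then (F (s m), 2 / 3 * (s m).2) else (fun=> 0, N).
have sG n : good (s n).
  elim: n => [|n IH] /=; last exact: (FP _ IH).1.
  split => /= [|//|x]; first exact: cst_continuous.
  by move: (uN x) (vN x) => ? ?; apply/andP; split; lra.
have s2 n : (s n).2 = (2 / 3) ^+ n * N.
  by elim: n => [|n IH]; rewrite ?expr0 ?mul1r//= IH exprS mulrA.
(* The intervals from [a n x] to [b n x] are nested: the centre moves by at most a third of the
   radius, which is just what the radius loses. Their common point is the limit [k x]. *)
pose a n x := (s n).1 x - (s n).2; pose b n x := (s n).1 x + (s n).2.
have ab_step n x : a n x <= a n.+1 x /\ b n.+1 x <= b n x.
  have [_ /(_ x)] := FP _ (sG n); rewrite /a /b /= ler_norml => /andP[? ?].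
  by split; lra.
have aD n m x : a n x <= a (n + m)%N x.
  elim: m => [|m IH]; first by rewrite addn0.
  by rewrite addnS (le_trans IH)//; case: (ab_step (n + m)%N x).
have bD n m x : b (n + m)%N x <= b n x.
  elim: m => [|m IH]; first by rewrite addn0.
  by rewrite addnS (le_trans _ IH)//; case: (ab_step (n + m)%N x).
have ab n m x : a n x <= b m x.
  rewrite (le_trans (aD n m x))// (le_trans _ (bD m n x))// [(m + n)%N]addnC.
  by rewrite /a /b; case: (sG (n + m)%N) => _ ? _; lra.
pose k x := sup (range (a^~ x)).
have ak n x : a n x <= k x.
  by apply: ub_le_sup; [exists (b 0%N x) => _ [m _ <-]|exists n].
have kb n x : k x <= b n x.
  by apply: ge_sup; [exists (a 0%N x), 0%N|move=> _ [m _ <-]].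
exists k; split.
  move=> z; apply/cvgrPdist_lt => e e0.
  have e3 : 0 < e / 3 by lra.
  have [n ne] := geometric_lt N0 e3.
  rewrite -s2 in ne.
  have [cn _ _] := sG n.
  have : nbhs z [set y | `|(s n).1 z - (s n).1 y| < e / 3].
    by have /cvgrPdist_lt := cn z; apply; lra.
  apply: filterS => y /=; rewrite !ltr_norml => /andP[? ?].
  move: (ak n z) (kb n z) (ak n y) (kb n y); rewrite /a /b => ? ? ? ?.
  by apply/andP; split; lra.
move=> x; apply/andP; split; apply/ler_addgt0Pl => e e0.
  have e2 : 0 < e / 2 by lra.
  have [n ne] := geometric_lt N0 e2.
  rewrite -s2 in ne; move: (kb n x) (ak n x); rewrite /a /b => ? ?.
  by have [_ _ /(_ x)/andP[? ?]] := sG n; lra.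
have e2 : 0 < e / 2 by lra.
  have [n ne] := geometric_lt N0 e2.
rewrite -s2 in ne; move: (kb n x) (ak n x); rewrite /a /b => ? ?.
by have [_ _ /(_ x)/andP[? ?]] := sG n; lra.
Qed.

(** * The Hahn-Banach theorem *)

Definition linear_form (R : realType) (E : lmodType R) (phi : E -> R) : Prop :=
  forall a x y, phi (a *: x + y) = a * phi x + phi y.

Lemma convex_setP (R : realType) (E : lmodType R) (V : set E) :
  @convex_set R E V <-> forall (x y : E) (t : R), V x -> V y -> 0 <= t <= 1 ->
    V (t *: x + (1 - t) *: y).
Proof.
split=> [cV x y t Vx Vy /andP[t0 t1]|cV x y t /set_mem Vx /set_mem Vy].
  have := cV x y (Itv01 t0 t1) (mem_set Vx) (mem_set Vy).
  by move/set_mem.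
by apply: mem_set; apply: cV => //; apply/andP; split.
Qed.

(* Graphs of linear forms on subspaces; single-valuedness is not required, since
   it follows from the bound on [V] as soon as [V 0]. *)
Definition bounded_subspace (R : realType) (E : lmodType R) (V : set E)
    (G : set (E * R)) : Prop :=
  (forall a p q, G p -> G q -> G (a *: p.1 + q.1, a * p.2 + q.2)) /\
  (forall p, G p -> V p.1 -> p.2 <= 1).

(** The one-dimensional extension step. A value [c] at [v] is admissible when it lies above all
    lower and below all upper bounds that [V] imposes; [sup low] does. *)
Lemma bounded_subspace_extend (R : realType) (E : lmodType R) (V : set E)
    (G : set (E * R)) (v : E) :
  (forall x y (t : R), V x -> V y -> 0 <= t <= 1 -> V (t *: x + (1 - t) *: y)) ->
  (forall x, exists2 t : R, 0 < t & V (t *: x)) ->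
  bounded_subspace V G -> G (0, 0) ->
  exists c, bounded_subspace V
    [set p | exists q t, G q /\ p = (q.1 + t *: v, q.2 + t * c)].
Proof.
move=> cV aV [Gl Gb] G0.
(* [low] collects the lower bounds that [V] imposes on the value at [v]. *)
pose low := [set c | exists q s, [/\ G q, 0 < s, V (q.1 - s *: v) & c = (q.2 - 1) / s]].
(* Every lower bound is below every upper bound: weights [s / (s + t)] and [t / (s + t)] on
   [q.1 + t *: v] and [p.1 - s *: v] cancel [v], leaving a point of [V] in the domain of [G]. *)
have lowP q t c : low c -> G q -> 0 < t -> V (q.1 + t *: v) -> c <= (1 - q.2) / t.
  move=> [p [s [Gp s0 Vp ->]]] Gq t0 Vq.
  have st0 : 0 < s + t by exact: addr_gt0.
  have stn : s + t != 0 by exact: lt0r_neq0.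
  have : G ((s / (s + t)) *: q.1 + (t / (s + t)) *: p.1,
            (s / (s + t)) * q.2 + (t / (s + t)) * p.2).
    have := Gl (t / (s + t)) _ _ Gp G0; rewrite !addr0 => Gp'.
    exact: (Gl (s / (s + t)) _ _ Gq Gp').
  move/Gb => /=.
  have -> : (s / (s + t)) *: q.1 + (t / (s + t)) *: p.1 =
      (s / (s + t)) *: (q.1 + t *: v) + (1 - s / (s + t)) *: (p.1 - s *: v).
    have -> : 1 - s / (s + t) = t / (s + t) by field.
    rewrite scalerBr !scalerDr !scalerA addrACA -addrA -scalerBl.
    by rewrite (_ : _ * t - _ = 0) ?scale0r ?addr0//; field.
  move=> /(_ (cV _ _ _ Vq Vp _)) H; have {}H : s / (s + t) * q.2 + t / (s + t) * p.2 <= 1.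
    apply: H; apply/andP; split; first by rewrite divr_ge0// ltW.
    by rewrite ler_pdivrMr// mul1r lerDl ltW.
  have {}H : s * q.2 + t * p.2 <= s + t.
    rewrite -[leRHS]mul1r -ler_pdivrMr//; apply: le_trans H.
    by rewrite le_eqVlt; apply/orP; left; apply/eqP; field.
  rewrite ler_pdivrMr// mulrAC ler_pdivlMr//; lra.
have low0 : low !=set0.
  have [s s0 Vs] := aV (- v).
  by exists ((0 - 1) / s), (0, 0), s; split => //=; rewrite sub0r -scalerN.
have [t1 t10 Vt1] := aV v.
have lub : has_ubound low.
  exists ((1 - 0) / t1) => c lc; apply: (lowP (0, 0)) => //=; by rewrite add0r.
exists (sup low); split.
  move=> a _ _ [p [s [Gp ->]]] [q [t [Gq ->]]] /=.
  exists (a *: p.1 + q.1, a * p.2 + q.2), (a * s + t); split; first exact: Gl.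
  congr (_, _) => /=; last by ring.
  by rewrite scalerDr scalerDl scalerA addrACA.
move=> _ [q [t [Gq ->]]] /= Vq.
have [t0|t0|t0] := ltgtP t 0.
- have : low ((q.2 - 1) / - t).
    by exists q, (- t); split => //; rewrite ?oppr_gt0// scaleNr opprK.
  move/(ub_le_sup lub); rewrite ler_pdivrMr ?oppr_gt0//; lra.
- have : sup low <= (1 - q.2) / t by apply: ge_sup => // c lc; exact: lowP.
  by rewrite ler_pdivlMr//; lra.
- by rewrite t0 mul0r addr0; apply: Gb => //; move: Vq; rewrite t0 scale0r addr0.
Qed.

(** Zorn's lemma extends the form with value [1] at [z] from the line through [z]; a maximal graph
    is defined everywhere, since otherwise [bounded_subspace_extend] would enlarge it. *)
Lemma hahn_banach_convex (R : realType) (E : lmodType R) (V : set E) (z : E) :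
  (forall x y (t : R), V x -> V y -> 0 <= t <= 1 -> V (t *: x + (1 - t) *: y)) ->
  (forall x, exists2 t : R, 0 < t & V (t *: x)) -> V 0 -> ~ V z ->
  exists phi : E -> R, [/\ linear_form phi, phi z = 1 & forall x, V x -> phi x <= 1].
Proof.
move=> cV aV V0 nVz.
pose L := [set p : E * R | p.1 = p.2 *: z].
have LB : bounded_subspace V L.
  split=> [a p q|[x t]]; rewrite /L /=.
    by move=> -> ->; rewrite scalerDl scalerA.
  move=> -> Vt.
  (* If [t *: z] were in [V] with [1 < t], then [z], on the segment from [0] to it, would be in
     [V]. *)
  rewrite leNgt; apply/negP => t1; apply: nVz.
  have t0 : 0 < t by exact: lt_trans t1.
  have := cV _ _ t^-1 Vt V0; rewrite scaler0 addr0 scalerA mulVf ?lt0r_neq0// scale1r.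
  by apply; rewrite invr_ge0 ltW//= invf_le1// ltW.
pose S := {G : set (E * R) | bounded_subspace V G /\ L `<=` G}.
pose Rel (G G' : S) := `[< sval G `<=` sval G' >].
pose SL : S := exist _ L (conj LB (@subset_refl _ L)).
have [|||[G GBL] Gmax] := @ZL_preorder S SL Rel.
- by move=> G; exact/asboolP.
- by move=> G G' G'' /asboolP GG' /asboolP G'G''; apply/asboolP; exact: subset_trans G'G''.
- move=> C Ctot; have [[C0 CC0]|Cn] := pselect (C !=set0); last first.
    by exists SL => G CG; exfalso; apply: Cn; exists G.
  pose U := \bigcup_(G in C) sval G.
  have UB : bounded_subspace V U /\ L `<=` U.
    split; last by move=> p Lp; exists C0 => //; exact: (svalP C0).2.
    split=> [a p q [G CG Gp] [G' CG' G'q]|p [G CG Gp]]; last exact: (svalP G).1.2.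
    case: (Ctot _ _ CG CG') => /asboolP GG'.
      by exists G' => //; apply: (svalP G').1.1 => //; exact: GG'.
    by exists G => //; apply: (svalP G).1.1 => //; exact: GG'.
  by exists (exist _ U UB : S) => G CG; apply/asboolP => p Gp; exists G.
have [GB LG] := GBL.
have G0 : G (0, 0) by apply: LG; rewrite /L /= scale0r.
have /choice[phi Gphi] : forall v, exists r, G (v, r).
  move=> v; have [c cB] := bounded_subspace_extend v cV aV GB G0.
  set G' := [set p | _] in cB.
  have GG' : G `<=` G'.
    by move=> q Gq; exists q, 0; split => //; rewrite scale0r mul0r !addr0; case: q {Gq}.
  have /asboolP/= G'G : Rel (exist _ G' (conj cB (subset_trans LG GG'))) (exist _ G GBL).
    exact/Gmax/asboolP.
  exists c; apply: G'G; exists (0, 0), 1; split => //=.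
  by rewrite !add0r scale1r mul1r.
(* Two values at [v] would give a nonzero value at [0], which scales to [2] and breaks the bound at
   [0]. *)
have Gfun v r r' : G (v, r) -> G (v, r') -> r = r'.
  move=> Gr Gr'; apply/eqP; rewrite -subr_eq0; apply/eqP.
  have := GB.1 (-1) _ _ Gr' Gr; rewrite /= scaleN1r mulN1r addNr addrC => Gd.
  apply: contrapT => /eqP dn0.
  have := GB.1 (2 / (r - r')) _ _ Gd G0; rewrite /= scaler0 !addr0 divfK//.
  by move/GB.2 => /(_ V0) /=; lra.
exists phi; split.
- move=> a x y; apply: Gfun (Gphi _) _.
  exact: GB.1 a _ _ (Gphi x) (Gphi y).
- by apply: Gfun (Gphi _) _; apply: LG; rewrite /L /= scale1r.
- by move=> x Vx; exact: (GB.2 _ (Gphi x)).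
Qed.

(** Apply [hahn_banach_convex] to an open convex neighbourhood of [0] that misses [x - y]; the bound
    on this neighbourhood also yields continuity. *)
Lemma linear_form_separates (R : realType) (E : tvsType R) (x y : E) :
  hausdorff_space E -> x <> y ->
  exists phi : E -> R, [/\ continuous phi, linear_form phi & phi x <> phi y].
Proof.
move=> hE xy; pose z := x - y.
have z0 : 0 != z :> E by apply/eqP => /esym/eqP; rewrite subr_eq0 => /eqP.
have [U [oU /set_mem U0 /set_mem nUz]] := hausdorff_accessible hE z0.
have [B Bcv [Bo Bb]] := @locally_convex R E.
have [V [BV V0] VU] : filter_from [set W | B W /\ W 0] id U.
  by apply: Bb; exact: open_nbhs_nbhs.
have /convex_setP cV := Bcv V (mem_set BV).
have nV0 : nbhs 0 V by apply: open_nbhs_nbhs; split => //; exact: Bo.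
have aV v : exists2 t : R, 0 < t & V (t *: v).
  have := @scale_continuous R E (0, v) V; rewrite /= scale0r => /(_ nV0).
  move=> [[A1 A2] /= [A10 A2v] AV].
  have [e /= e0 eA] := A10.
  exists (e / 2); first by rewrite divr_gt0.
  apply: (AV (e / 2, v)); split => /=; last exact: nbhs_singleton.
  by apply: eA; rewrite /= sub0r normrN gtr0_norm; lra.
have [phi [lphi phiz phi1]] := hahn_banach_convex cV aV V0 (fun Vz => nUz (VU _ Vz)).
exists phi; split => //; last first.
  move=> e; have := lphi (-1) y x; rewrite scaleN1r addrC -/z phiz e mulN1r addNr.
  by move/eqP; rewrite oner_eq0.
have phi0 : phi 0 = 0 by have := lphi (-1) 0 0; rewrite scaler0 addr0; lra.
have phiN v : phi (- v) = - phi v.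
  by have := lphi (-1) v 0; rewrite scaleN1r addr0 phi0; lra.
move=> v; apply/cvgrPdist_lt => e e0.
have e2 : e / 2 != 0 by rewrite lt0r_neq0// divr_gt0.
have nW : nbhs 0 (V `&` (-%R @` V)) by apply: filterI => //; exact: nbhs0N.
(* On the intersection of [V] and [- V] the form is at most [1] in absolute value, so it varies by
   at most [e / 2] on the translate by [v] of [e / 2] times this set. *)
apply: filterS (nbhsT v (nbhs0Z e2 nW)) => _ [_ [w [Vw [w' Vw' ww']] <-] <-].
have := phi1 _ Vw; have := phi1 _ Vw'; rewrite -[w']opprK ww' phiN => ? ?.
rewrite [v + _]addrC lphi ltr_norml.
by apply/andP; split; nra.
Qed.

(** * Lifting *)

Lemma compact_bigcap_directed (X : topologicalType) (I : Type) (D : set I)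
    (C : I -> set X) :
  compact [set: X] -> D !=set0 ->
  (forall i j, D i -> D j -> exists2 k, D k & C k `<=` C i `&` C j) ->
  (forall i, D i -> closed (C i) /\ C i !=set0) ->
  exists x, forall i, D i -> C i x.
Proof.
move=> cX [i0 Di0] dirC CP.
have FF : Filter (filter_from D C) by apply: filter_from_filter; [exists i0|].
have PF : ProperFilter (filter_from D C).
  by apply: filter_from_proper => i /CP[].
have [x [_ clx]] := cX _ PF filterT.
exists x => i Di; apply: (CP i Di).1 => B nB; apply: clx => //.
by exists i.
Qed.

(* By compactness, [W] is the union of the finite intersections of members of [G]
   that it contains. *)
Lemma lt_union_closed_separated (A : Type) (X : topologicalType)
    (G : set (set X)) (W : set X) :
  card_lt [set: nat] [set: A] -> compact [set: X] -> card_lt G [set: A] ->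
  G `<=` closed -> open W ->
  (forall l l', W l -> ~ W l' -> exists2 B, G B & B l /\ ~ B l') ->
  lt_union_closed A W.
Proof.
move=> Ainf cX Glt Gcl oW sepW.
pose cap (s : seq (set X)) := foldr setI setT s.
have cap_closed s : allin G s -> closed (cap s).
  elim: s => [_|B s IH /allin_cons[GB Gs]] /=; first exact: closedT.
  by apply: closedI; [exact: Gcl|exact: IH].
exists (cap @` [set s | allin G s] `&` [set C | C `<=` W]).
  apply: card_le_lt (card_lt_seq Ainf Glt).
  by apply: card_le_trans (card_image_le cap _); apply: subset_card_le => ? [].
split; first by move=> _ [[s Gs <-] _]; exact: cap_closed.
apply/seteqP; split=> [l Wl|l [C [_ CW] Cl]]; last exact: CW.
suff [s [Gs sl] sW] : exists2 s, allin [set B | G B /\ B l] s /\ cap s l & cap s `<=` W.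
  exists (cap s) => //; split => //; exists s => //.
  by apply: sub_allin Gs => B [].
(* Otherwise the finite intersections through [l] all meet the complement of [W]. These traces are
   closed and directed, so they share a point [l'] outside [W] that no member of [G] separates from
   [l]. *)
apply: contrapT => ns.
have capl s : allin [set B | G B /\ B l] s -> cap s l.
  by elim: s => // B s IH /allin_cons[[_ Bl] /IH].
have [|s t Gs Gt|s Gs|l' l'P] := @compact_bigcap_directed X _
    [set s | allin [set B | G B /\ B l] s] (fun s => cap s `&` ~` W) cX.
- by exists [::].
- exists (s ++ t); first exact/allin_cat.
  suff -> : cap (s ++ t) = cap s `&` cap t by move=> x [[? ?] ?].
  by elim: s {Gs} => [|B s IH] /=; rewrite ?setTI// IH setIA.
- split.
    apply: closedI; last exact: open_closedC.
    by apply: cap_closed; apply: sub_allin Gs => B [].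
  apply: contrapT => nW; apply: ns; exists s; first by split => //; exact: capl.
  by move=> x sx; apply: contrapT => Wx; apply: nW; exists x.
have Wl' : ~ W l' by case: (l'P [::] isT).
have [B GB [Bl nBl']] := sepW _ _ Wl Wl'.
have [|[]//] := l'P [:: B].
exact/allin_cons.
Qed.

(** The complements of base members are the separating closed sets: a base set around the point
    outside [U] can avoid the point inside. *)
Lemma accessible_HL_space (A : Type) (X : topologicalType) :
  card_lt [set: nat] [set: A] -> compact [set: X] -> accessible_space X ->
  card_lt (weight X) [set: A] -> HL_space A X.
Proof.
move=> Ainf cX T1 wX; split => // U oU.
have [[wo wb] _] := weightP X.
apply: (@lt_union_closed_separated _ _ (setC @` weight X)) => //.
- by apply: card_le_lt wX; exact: card_image_le.
- by move=> _ [B wB <-]; apply: open_closedC; exact: wo.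
move=> l l' Ul Ul'; have l'l : l' != l by apply/eqP => e; apply: Ul'; rewrite e.
have [V [oV /set_mem Vl' /set_mem Vl]] := T1 _ _ l'l.
have [B [wB Bl'] BV] := wb l' _ (open_nbhs_nbhs (conj oV Vl')).
by exists (~` B); [exists B|split => [/BV//|]; exact].
Qed.

Lemma near_prod_neq (X K F : topologicalType) (f : K -> F) (p : X -> F) x l :
  hausdorff_space F -> {for x, continuous f} -> {for l, continuous p} ->
  p l <> f x -> \forall l' \near l & x' \near x, p l' <> f x'.
Proof.
rewrite open_hausdorff => hF cf cp /eqP/hF[[U V] /= [/set_mem Ul /set_mem Vx]].
move=> [oU oV /eqP UV].
exists (p @^-1` U, f @^-1` V) => /=.
  by split; [apply: cp|apply: cf]; exact: open_nbhs_nbhs.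
move=> [l' x'] [/= Ul' Vx'] e.
suff : (U `&` V) (p l') by rewrite UV.
by split => //; rewrite e.
Qed.

Lemma closed_fiber_eq (X F : topologicalType) (p : X -> F) (y : F) :
  hausdorff_space F -> continuous p -> closed [set l | p l = y].
Proof.
move=> hF cp; apply: (@closed_comp _ _ p [set y]); first by move=> *; exact: cp.
exact/accessible_closed_set1/hausdorff_accessible.
Qed.

(** * Fibers of points with prescribed coordinates, and the transfinite choice of coordinates *)

Definition fiber (X K F I : Type) (R : Type) (p : X -> F) (phi : I -> X -> R)
    (f : K -> F) (h : I -> K -> R) (D : set I) (x : K) : set X :=
  [set l | p l = f x /\ forall i, D i -> phi i l = h i x].

Lemma fiber_closed (R : realType) (X K F : topologicalType) (I : Type)
    (p : X -> F) (phi : I -> X -> R) (f : K -> F) (h : I -> K -> R) (D : set I) x :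
  hausdorff_space F -> continuous p -> (forall i, continuous (phi i)) ->
  closed (fiber p phi f h D x).
Proof.
move=> hF cp cphi.
rewrite (_ : fiber _ _ _ _ _ _ =
  [set l | p l = f x] `&` \bigcap_(i in D) [set l | phi i l = h i x]); last first.
  by apply/seteqP; split=> l [].
apply: closedI; first exact: closed_fiber_eq.
by apply: closed_bigI => i _; apply: closed_fiber_eq => //; exact: Rhausdorff.
Qed.

(** Upper semicontinuity of the fiber. If the fiber at [x] misses [C], each point of [C] violates
    one defining equation at [x], and still does so after a small move of the point and of [x];
    compactness of [C] makes the move of [x] uniform. *)
Lemma fiber_meets_closed (R : realType) (X K F : topologicalType) (I : Type)
    (p : X -> F) (phi : I -> X -> R) (f : K -> F) (h : I -> K -> R) (D : set I)
    (C : set X) :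
  compact [set: X] -> hausdorff_space F -> continuous p ->
  (forall i, continuous (phi i)) -> continuous f ->
  (forall i, D i -> continuous (h i)) -> closed C ->
  closed [set x | fiber p phi f h D x `&` C !=set0].
Proof.
move=> cX hF cp cphi cf ch clC; rewrite -openC openE => x nx.
have cC : compact C by exact: subclosed_compact cX _.
have /compact_near_coveringP/(_ K (nbhs x)
  (fun x' l => ~ fiber p phi f h D x' l)) := cC.
move=> /(_ _ _) near_nfib.
suff : \forall x' \near x, C `<=` [set l | ~ fiber p phi f h D x' l].
  by apply: filterS => x' Cx' [l [fl Cl]]; exact: Cx' Cl fl.
apply: near_nfib => l Cl.
have [plx|/(near_prod_neq hF (cf x) (cp l))] := pselect (p l = f x); last first.
  by apply: filterS => -[l' x'] /= np [].
have [i Di phx] : exists2 i, D i & phi i l <> h i x.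
  apply: contrapT => ni; apply: nx; exists l; split => //; split => // i Di.
  by apply: contrapT => ?; apply: ni; exists i.
apply: filterS (near_prod_neq (@Rhausdorff R) (ch i Di x) (cphi i l) phx).
by move=> [l' x'] /= np [_ /(_ i Di)].
Qed.

(** Once all coordinates are prescribed the fiber is a single point, and a single-valued upper
    semicontinuous map is continuous. *)
Lemma fiber_continuous (R : realType) (X K F : topologicalType) (I : Type)
    (p : X -> F) (phi : I -> X -> R) (f : K -> F) (h : I -> K -> R) (g : K -> X) :
  compact [set: X] -> hausdorff_space F -> continuous p ->
  (forall i, continuous (phi i)) -> continuous f ->
  (forall i, continuous (h i)) ->
  (forall l l', p l = p l' -> (forall i, phi i l = phi i l') -> l = l') ->
  (forall x, fiber p phi f h setT x (g x)) -> continuous g.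
Proof.
move=> cX hF cp cphi cf ch inj gP; apply/continuousP => U oU.
have clU : closed (~` U) by exact: open_closedC.
have := fiber_meets_closed cX hF cp cphi cf (fun i _ => ch i) clU (D := setT).
rewrite -openC; congr open; apply/seteqP; split=> x /=.
  by move=> nx; apply: contrapT => Ux; apply: nx; exists (g x).
move=> Ux [l [[pl phil] nUl]]; apply: nUl.
have [pg phig] := gP x.
rewrite (inj l (g x)) ?pl ?pg// => i.
by rewrite phil// phig.
Qed.

(** The limit stage: the fibers for the segments up to each [i] in [D] form a chain of nonempty
    closed sets. The point [l0] serves an empty [D]. *)
Lemma fiber_inhabited_limit (R : realType) (X K F : topologicalType) (I : Type)
    (lt : I -> I -> Prop)
    (p : X -> F) (phi : I -> X -> R) (f : K -> F) (h : I -> K -> R) (D : set I) x :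
  compact [set: X] -> hausdorff_space F -> continuous p ->
  (forall i, continuous (phi i)) ->
  (forall i j k, lt i j -> lt j k -> lt i k) ->
  (forall i j, [\/ lt i j, i = j | lt j i]) ->
  (exists l, p l = f x) ->
  (forall i, D i -> fiber p phi f h [set j | lt j i \/ j = i] x !=set0) ->
  fiber p phi f h D x !=set0.
Proof.
move=> cX hF cp cphi trans tri [l0 l0x] Dfib.
have [D0|D0] := pselect (D !=set0); last first.
  by exists l0; split=> // i Di; exfalso; apply: D0; exists i.
have [|i j Di Dj|i Di|l lP] := @compact_bigcap_directed X _ D
    (fun i => fiber p phi f h [set j | lt j i \/ j = i] x) cX => //.
- case: (tri i j) => [ij|<-|ji]; [exists j|exists i|exists i] => //.
  + move=> l [pl phil]; split; split=> // k [ki|->]; apply: phil; left => //.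
    exact: trans ij.
  + move=> l [pl phil]; split; split=> // k [kj|->]; apply: phil; left => //.
    exact: trans ji.
- by split; [exact: fiber_closed|exact: Dfib].
exists l; split=> [|i Di]; last by apply: (lP i Di).2; right.
by have [i Di] := D0; case: (lP i Di).
Qed.

(** Insert [k] between the minimum [u] and the maximum [v] of [psi] on [S x]. The sets [{v < r}] and
    [{r < u}] consist of the [x] whose [S x] misses a closed half of [X], so the hypotheses on [S]
    make them open unions of few closed sets. *)
Lemma select_step (R : realType) (A : Type) (X K : topologicalType)
    (S : K -> set X) (psi : X -> R) :
  F_space A K -> hausdorff_space K -> compact [set: X] -> continuous psi ->
  (forall x, S x !=set0) -> (forall x, closed (S x)) ->
  (forall C, closed C -> closed [set x | S x `&` C !=set0]) ->
  (forall C, closed C -> lt_union_closed A [set x | ~ (S x `&` C !=set0)]) ->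
  (forall x a b c, S x a -> S x b -> psi a <= c <= psi b ->
    exists2 l, S x l & psi l = c) ->
  exists k : K -> R, continuous k /\ forall x, exists2 l, S x l & psi l = k x.
Proof.
move=> [cK FK] hK cX cpsi S0 Scl Sclosed Slt Sitv.
have cS x : compact (S x) by exact: subclosed_compact cX _.
have wpsi B : {within B, continuous psi} by exact: continuous_subspaceT.
have /choice[lmin minP] : forall x, exists l, S x l /\ forall l', S x l' -> psi l <= psi l'.
  move=> x; have [l /set_mem Sl lP] := compact_EVT_min (S0 x) (cS x) (wpsi _).
  by exists l; split=> // l' Sl'; apply: lP; exact: mem_set.
have /choice[lmax maxP] : forall x, exists l, S x l /\ forall l', S x l' -> psi l' <= psi l.
  move=> x; have [l /set_mem Sl lP] := compact_EVT_max (S0 x) (cS x) (wpsi _).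
  by exists l; split=> // l' Sl'; apply: lP; exact: mem_set.
pose u x := psi (lmin x); pose v x := psi (lmax x).
have uv x : u x <= v x by apply: (minP x).2; exact: (maxP x).1.
have clge r : closed [set l | r <= psi l].
  by apply: (@closed_comp _ _ psi [set y | r <= y]); [move=> *; exact: cpsi|exact: closed_ge].
have clle r : closed [set l | psi l <= r].
  by apply: (@closed_comp _ _ psi [set y | y <= r]); [move=> *; exact: cpsi|exact: closed_le].
have vE r : [set x | v x < r] = [set x | ~ (S x `&` [set l | r <= psi l] !=set0)].
  apply/seteqP; split=> x /=.
    move=> vr [l [Sl rl]]; move: vr; rewrite ltNge => /negP; apply.
    by apply: le_trans rl _; exact: (maxP x).2.
  move=> nS; rewrite ltNge; apply/negP => rv; apply: nS; exists (lmax x).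
  by split => //; exact: (maxP x).1.
have uE r : [set x | r < u x] = [set x | ~ (S x `&` [set l | psi l <= r] !=set0)].
  apply/seteqP; split=> x /=.
    move=> ur [l [Sl rl]]; move: ur; rewrite ltNge => /negP; apply.
    by apply: le_trans rl; exact: (minP x).2.
  move=> nS; rewrite ltNge; apply/negP => rv; apply: nS; exists (lmin x).
  by split => //; exact: (minP x).1.
have [N [N0 psiN]] : exists N : R, 0 <= N /\ forall l, `|psi l| <= N.
  have [X0|X0] := pselect ([set: X] !=set0); last first.
    by exists 0; split => // l; exfalso; apply: X0; exists l.
  have [a _ aP] := compact_EVT_min X0 cX (wpsi _).
  have [b _ bP] := compact_EVT_max X0 cX (wpsi _).
  exists (`|psi a| + `|psi b|); split => [|l]; first by rewrite addr_ge0.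
  have := aP l; have := bP l; rewrite !inE => /(_ I) ? /(_ I) ?.
  have := ler_norm (psi b); have := ler_norm (- psi a); rewrite normrN => ? ?.
  have := normr_ge0 (psi b); have := normr_ge0 (psi a) => ? ?.
  by rewrite ler_norml; apply/andP; split; lra.
have [||||k [ck kuv]] := @insertion R K u v N _ N0.
- exact: compact_normal.
- by move=> x; have := psiN (lmin x); rewrite ler_norml => /andP[].
- by move=> x; have := psiN (lmax x); rewrite ler_norml => /andP[].
- move=> r; apply: FK.
  + by rewrite vE; exact: closed_openC (Sclosed _ (clge r)).
  + by rewrite uE; exact: closed_openC (Sclosed _ (clle r)).
  + rewrite -subset0 => x [/= vr ru]; have := uv x; lra.
  + by rewrite vE; exact: Slt.
  + by rewrite uE; exact: Slt.
exists k; split=> // x.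
exact: Sitv (minP x).1 (maxP x).1 (kuv x).
Qed.

(** Working with saturated subsets of [X] for this equivalence replaces the image of [X] under [p]
    and the coordinates in [D]. *)
Definition same_coords (X F I R : Type) (p : X -> F) (phi : I -> X -> R)
    (D : set I) (l c : X) : Prop :=
  p l = p c /\ forall i, D i -> phi i l = phi i c.

Lemma lift_coordinates (R : realType) (A : Type) (X K F : topologicalType) (I : Type)
    (lt : I -> I -> Prop) (p : X -> F) (phi : I -> X -> R) (f : K -> F) :
  F_space A K -> hausdorff_space K -> compact [set: X] -> hausdorff_space F ->
  continuous p -> (forall i, continuous (phi i)) -> continuous f ->
  (forall x, exists l, p l = f x) ->
  well_founded lt ->
  (forall i j k, lt i j -> lt j k -> lt i k) ->
  (forall i j, [\/ lt i j, i = j | lt j i]) ->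
  (forall i C, closed C -> lt_union_closed A
    [set l | ~ exists2 c, C c & same_coords p phi [set j | lt j i] l c]) ->
  (forall i D a b t, same_coords p phi D a b -> phi i a <= t <= phi i b ->
    exists2 l, same_coords p phi D l a & phi i l = t) ->
  exists h : I -> K -> R, (forall i, continuous (h i)) /\
    forall x, fiber p phi f h setT x !=set0.
Proof.
move=> FK hK cX hF cp cphi cf surj wf trans tri sat itv.
pose pre i (g : I -> K -> R) := (forall j, lt j i -> continuous (g j)) /\
  forall x, fiber p phi f g [set j | lt j i] x !=set0.
pose post i (g : I -> K -> R) (k : K -> R) := continuous k /\
  forall x, exists2 l, fiber p phi f g [set j | lt j i] x l & phi i l = k x.
(* The choice of the next coordinate is made total, so that it can be used before [pre] is known to
   hold along the recursion. *)
have /choice[next nextP] : forall ig, exists k, pre ig.1 ig.2 -> post ig.1 ig.2 k.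
  move=> [i g] /=; have [[cg fg]|] := pselect (pre i g); last by exists (fun=> 0).
  suff [k kP] : exists k, post i g k by exists k.
  apply: (@select_step R A X K (fiber p phi f g [set j | lt j i]) (phi i)) => //.
  - by move=> x; exact: fiber_closed.
  - by move=> C clC; exact: fiber_meets_closed.
  (* A fiber for the coordinates before [i] is a whole class of [same_coords]. Hence it misses [C]
     exactly when it meets some member of [G], and meeting a closed set is a closed condition on
     [x]. *)
  - move=> C clC; have [G Glt [Gcl GE]] := sat i C clC.
    exists ((fun B => [set x | fiber p phi f g [set j | lt j i] x `&` B !=set0]) @` G).
      by apply: card_le_lt Glt; exact: card_image_le.
    split; first by move=> _ [B GB <-]; apply: fiber_meets_closed => //; exact: Gcl.
    have GW l : (exists2 B, G B & B l) <->
        ~ exists2 c, C c & same_coords p phi [set j | lt j i] l c.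
      by move/seteqP: GE => [WG GW]; split=> [[B GB Bl]|/WG[B GB Bl]];
        [apply: GW; exists B|exists B].
    apply/seteqP; split=> x /=.
      move=> nC; have [l [pl phil]] := fg x.
      have [|B GB Bl] := (GW l).2; last by exists [set x | fiber p phi f g [set j | lt j i] x `&` B !=set0]; [exists B|exists l].
      move=> [c Cc [pc phic]]; apply: nC; exists c; split => //; split; first by rewrite -pc.
      by move=> j ji; rewrite -phic// phil.
    move=> [_ [B GB <-] /= [l [[pl phil] Bl]]] [c [[pc phic] Cc]].
    have /GW : exists2 B, G B & B l by exists B.
    apply; exists c => //; split; first by rewrite pl.
    by move=> j ji; rewrite phil// phic.
  - move=> x a b t [pa phia] [pb phib] ab.
    have [|l [pl phil] lt'] := itv i [set j | lt j i] a b t _ ab.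
      by split=> [|j ji]; rewrite ?pa ?phia// phib.
    by exists l => //; split=> [|j ji]; rewrite ?pl// phil// phia.
(* Only earlier coordinates are available; the zero function fills the other indices, which the
   fiber before [i] does not see. *)
pose step i (rec : forall j, lt j i -> K -> R) : K -> R :=
  next (i, fun j => if pselect (lt j i) is left ji then rec j ji else fun=> 0).
pose h := Fix wf (fun=> K -> R) step.
have hE i : h i = next (i, fun j => if `[< lt j i >] then h j else fun=> 0).
  rewrite /h Fix_eq.
    congr (next (_, _)); apply/funext => j.
    by case: pselect => ji; case: asboolP.
  move=> j r r' rr'; congr (next (_, _)); apply/funext => k.
  by case: pselect => //= ?; rewrite rr'.
have fibE i x : fiber p phi f (fun j => if `[< lt j i >] then h j else fun=> 0)
    [set j | lt j i] x = fiber p phi f h [set j | lt j i] x.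
  apply/seteqP; split=> l [pl phil]; split=> // j ji; rewrite phil//;
    by case: asboolP.
have hP i : continuous (h i) /\
    forall x, fiber p phi f h [set j | lt j i \/ j = i] x !=set0.
  elim/(well_founded_ind wf): i => i IH.
  have [] := nextP (i, fun j => if `[< lt j i >] then h j else fun=> 0).
    split=> /= [j ji|x].
      by case: asboolP => // _; case: (IH j ji).
    rewrite fibE; apply: (fiber_inhabited_limit (lt := lt)) => // j ji.
    by case: (IH j ji).
  rewrite -hE /= => chi hi; split=> // x.
  have [l + phil] := hi x; rewrite fibE => -[pl lti].
  by exists l; split=> // j [/lti//|->].
exists h; split=> [i|x]; first by case: (hP i).
by apply: (fiber_inhabited_limit (lt := lt)) => // i _; case: (hP i).
Qed.

(** This is [fiber_meets_closed] with [X] itself as parameter space, [p] as [f] and [phi] as [h]: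
    the fiber at [l] is then the class of [l]. *)
Lemma same_coords_open (R : realType) (X F : topologicalType) (I : Type)
    (p : X -> F) (phi : I -> X -> R) (D : set I) (C : set X) :
  compact [set: X] -> hausdorff_space F -> continuous p ->
  (forall i, continuous (phi i)) -> closed C ->
  open [set l | ~ exists2 c, C c & same_coords p phi D l c].
Proof.
move=> cX hF cp cphi clC.
have := fiber_meets_closed cX hF cp cphi cp (fun i _ => cphi i) clC (D := D).
rewrite -openC; congr open; apply/seteqP; split=> l /= nl.
  move=> [c Cc [pc phic]]; apply: nl; exists c; split=> //; split=> // i Di.
  by rewrite phic.
move=> [c [[pc phic] Cc]]; apply: nl; exists c => //; split=> // i Di.
by rewrite phic.
Qed.

(** * Compact sets as spaces, and lifting through affine surjections *)

Lemma continuous_val (X : topologicalType) (L : set X) :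
  continuous (val : set_type L -> X).
Proof. exact: (@initial_continuous _ _ (@set_val X L)). Qed.

Lemma compact_set_type (X : topologicalType) (L : set X) :
  compact L -> compact [set: set_type L].
Proof.
move=> cL G PG _.
have [|x [Lx clx]] := cL (fmap (@set_val X L) G) _.
  by apply: (@filterS _ G _ _ _ _ filterT) => l _; exact: (set_valP l).
exists (SigSub (mem_set Lx)); split=> // B C GB [_ [[V oV <-] /= Vx] VC].
have [|_ [[l Bl <-] Vl]] := clx (set_val @` B) V _ (open_nbhs_nbhs (conj oV Vx)).
  by apply: (@filterS _ G _ B) => // l Bl; exists l.
by exists l; split => //; exact: VC.
Qed.

Lemma hausdorff_set_type (X : topologicalType) (L : set X) :
  hausdorff_space X -> hausdorff_space (set_type L).
Proof.
move=> hX l l' ll'; apply: val_inj; apply: hX => U V Ul Vl'.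
have [||m [Um Vm]] := ll' (set_val @^-1` U) (set_val @^-1` V).
- exact: continuous_val Ul.
- exact: continuous_val Vl'.
by exists (val m).
Qed.

(** Convexity supplies the intermediate values that [lift_coordinates] asks for, and [sep] reduces
    the final fibers to points. *)
Lemma affine_lift (R : realType) (A : Type) (K : topologicalType) (E F : tvsType R)
    (L : set E) (M : set F) (p : E -> F) (f : K -> F) (I : Type)
    (lt : I -> I -> Prop) (phi : I -> E -> R) :
  F_space A K -> hausdorff_space K -> compact_convex L -> hausdorff_space F ->
  affine_surjection L M p -> continuous f -> range f `<=` M ->
  well_founded lt ->
  (forall i j k, lt i j -> lt j k -> lt i k) ->
  (forall i j, [\/ lt i j, i = j | lt j i]) ->
  (forall i, continuous (phi i)) -> (forall i, linear_form (phi i)) ->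
  (forall x y, L x -> L y -> (forall i, phi i x = phi i y) -> x = y) ->
  (forall i (C : set (set_type L)), closed C -> lt_union_closed A
    [set l | ~ exists2 c, C c &
      same_coords (p \o @set_val E L) (fun i => phi i \o @set_val E L) [set j | lt j i] l c]) ->
  exists g : K -> E, [/\ continuous g, range g `<=` L & p \o g = f].
Proof.
move=> FK hK [hE cL cvL] hF [cp affp pLM] cf fM wf trans tri cphi lphi sep sat.
have cX := compact_set_type cL.
have cval := @continuous_val E L.
have cpv : continuous (p \o @set_val E L : set_type L -> F).
  exact/(@subspace_sigL_continuousP _ L _ p).
have cphiv i : continuous (phi i \o @set_val E L : set_type L -> R).
  by move=> x; apply: continuous_comp; [exact: cval|exact: cphi].
have [|i D a b t [pab phiab] /andP[at_ tb]|h [ch hfib]] :=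
  @lift_coordinates R A (set_type L) K F I lt (p \o @set_val E L) (fun i => phi i \o @set_val E L) f
    FK hK cX hF cpv cphiv cf _ wf trans tri sat.
- move=> x; have : M (f x) by apply: fM; exists x.
  by rewrite -pLM => -[l Ll lx]; exists (SigSub (mem_set Ll)).
- have [s /andP[s0 s1] sE] : exists2 s : R, 0 <= s <= 1 &
      s * phi i (val a) + (1 - s) * phi i (val b) = t.
    have [e|ne] := eqVneq (phi i (val a)) (phi i (val b)).
      exists 1; first by rewrite ler01 lexx.
      by move: at_ tb => /=; rewrite e => ? ?; lra.
    have ab : 0 < phi i (val b) - phi i (val a).
      by rewrite subr_gt0 lt_neqAle ne; exact: le_trans at_ tb.
    exists ((phi i (val b) - t) / (phi i (val b) - phi i (val a))).
      apply/andP; split; first by apply: divr_ge0; [rewrite subr_ge0; exact: tb|exact: ltW].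
      by rewrite ler_pdivrMr// mul1r; move: at_ => /=; lra.
    by field; rewrite lt0r_neq0.
  (* Where [a] and [b] agree, under [p] or a coordinate in [D], affinity makes [q] agree with them;
     [s] was chosen so that the [i]-th coordinate is [t]. *)
  pose q : E := s *: val a + (1 - s) *: val b.
  have phiq j : phi j q = s * phi j (val a) + (1 - s) * phi j (val b).
    have phi0 : phi j 0 = 0 by have := lphi j (-1) 0 0; rewrite scaler0 addr0; lra.
    by rewrite /q lphi -[(1 - s) *: _]addr0 lphi phi0 addr0.
  have Lq : L q.
    apply: ((convex_setP L).1 cvL) => //; [exact: set_valP|exact: set_valP|].
    exact/andP.
  exists (SigSub (mem_set Lq)); last by rewrite /= phiq.
  split=> [|j Dj] /=.
    have ep : p (val a) = p (val b) := pab.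
    have := affp (val a) (val b) (Itv01 s0 s1) (set_valP a) (set_valP b).
    by rewrite -ep convmm.
  have ej : phi j (val a) = phi j (val b) := phiab j Dj.
  by rewrite phiq -[RHS]/(phi j (val a)) ej; ring.
have /choice[g gP] : forall x, exists l,
    fiber (p \o @set_val E L) (fun i => phi i \o @set_val E L) f h setT x l.
  by move=> x; have [l] := hfib x; exists l.
have cg : continuous g.
  apply: (fiber_continuous cX hF cpv cphiv cf ch _ gP) => l l' _ e.
  by apply: val_inj; apply: sep => //; exact: set_valP.
exists (val \o g); split.
- by move=> x; apply: continuous_comp; [exact: cg|exact: cval].
- by move=> _ [x _ <-]; exact: set_valP.
- by apply/funext => x; case: (gP x).
Qed.

(** One form for each pair of points of [E], in any well-order: every open subset of [L] is already
    a small union of closed sets. *)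
Lemma HL_lifts (R : realType) (A : Type) (K : topologicalType) (E F : tvsType R)
    (L : set E) (M : set F) (p : E -> F) (f : K -> F) :
  F_space A K -> hausdorff_space K -> compact_convex L -> compact_convex M ->
  HL_space A (set_type L) ->
  affine_surjection L M p -> continuous f -> range f `<=` M ->
  exists g : K -> E, [/\ continuous g, range g `<=` L & p \o g = f].
Proof.
move=> FK hK ccL [hF _ _] [cX HL] ap cf fM.
have [hE cL _] := ccL.
have [lt [wf trans tri]] := well_founded_order (E * E).
have /choice[phi phiP] : forall xy : E * E, exists phi : E -> R,
    [/\ continuous phi, linear_form phi & xy.1 <> xy.2 -> phi xy.1 <> phi xy.2].
  move=> [x y]; have [->|xy] := pselect (x = y).
    exists (fun=> 0); split=> // [|a b c]; first exact: cst_continuous.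
    by rewrite mulr0 addr0.
  by have [phi [? ? ?]] := linear_form_separates hE xy; exists phi.
apply: (@affine_lift R A K E F L M p f _ lt phi) => //.
- by move=> i; case: (phiP i).
- by move=> i; case: (phiP i).
- move=> x y _ _ e; apply: contrapT => xy.
  by case: (phiP (x, y)) => _ _ /(_ xy); exact.
move=> i C clC; apply: HL; apply: same_coords_open => //.
- by case: ap => cp _ _; exact/(@subspace_sigL_continuousP _ L _ p).
- move=> j x; apply: continuous_comp; last by case: (phiP j) => + _ _; exact.
  exact: continuous_val.
Qed.

Lemma weight_lifts (R : realType) (A : Type) (K : topologicalType) (E F : tvsType R)
    (L : set E) (M : set F) (p : E -> F) (f : K -> F) :
  card_lt [set: nat] [set: A] ->
  F_space A K -> hausdorff_space K -> compact_convex L -> compact_convex M ->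
  card_lt (weight (set_type M)) [set: A] -> weight (set_type L) #<= [set: A] ->
  affine_surjection L M p -> continuous f -> range f `<=` M ->
  exists g : K -> E, [/\ continuous g, range g `<=` L & p \o g = f].
Proof.
move=> Ainf FK hK ccL [hF cM _] wM wL ap cf fM.
have [hE cL _] := ccL; have cX := compact_set_type cL.
have cval := @continuous_val E L.
have cpv : continuous (p \o @set_val E L : set_type L -> F).
  by case: ap => cp _ _; exact/(@subspace_sigL_continuousP _ L _ p).
have [W [lt [AW wf trans tri seg]]] := initial_order A.
have [[wLo wLb] _] := weightP (set_type L).
have [[wMo wMb] _] := weightP (set_type M).
have infA : infinite_set [set: A] by apply/infiniteP; exact: Ainf.1.
have W0 : [set: set_type W] !=set0.
  by apply: infinite_setN0; apply/infiniteP; exact: card_le_trans Ainf.1 AW.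
(* Pairs of base members of [L] are at most as many as [A], so [W] can index one form for each
   pair. *)
have [e _ eI] := card_le_inj_fun W0
  (card_le_trans (card_le_setX infA wL wL) AW).
pose separates (BC : set (set_type L) * set (set_type L)) (phi : E -> R) :=
  forall x y, BC.1 x -> BC.2 y -> phi (val x) <> phi (val y).
(* The index of a pair receives a form separating its two base sets if one exists; all other indices
   receive the zero form. *)
have /choice[phi phiP] : forall w, exists phi : E -> R,
    [/\ continuous phi, linear_form phi & forall BC,
      (weight (set_type L) `*` weight (set_type L)) BC -> e BC = w ->
      (exists psi, [/\ continuous psi, linear_form psi & separates BC psi]) ->
      separates BC phi].
  move=> w; have [[BC [wBC eBC [psi [cpsi lpsi sepsi]]]]|nBC] := pselect (exists BC,
      [/\ (weight (set_type L) `*` weight (set_type L)) BC, e BC = w &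
       exists psi, [/\ continuous psi, linear_form psi & separates BC psi]]).
    exists psi; split=> // BC' wBC' eBC' _.
    by rewrite (eI BC' BC) ?eBC ?eBC'//; exact: mem_set.
  exists (fun=> 0); split=> [|a b c|BC wBC eBC psi]; first exact: cst_continuous.
    by rewrite mulr0 addr0.
  by exfalso; apply: nBC; exists BC.
have cphi w : continuous (phi w) by case: (phiP w).
have cphiv w : continuous (phi w \o @set_val E L : set_type L -> R).
  by move=> x; apply: continuous_comp; [exact: cval|exact: cphi].
apply: (@affine_lift R A K E F L M p f _ lt phi) => //.
- by move=> i; case: (phiP i).
(* A form with different values at [x] and [y] separates small base sets around them, so the form
   indexed by that pair of base sets also tells [x] from [y]. *)
- move=> x y Lx Ly exy; apply: contrapT => xy.
  have [psi [cpsi lpsi]] := linear_form_separates hE xy.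
  pose x' : set_type L := SigSub (mem_set Lx).
  pose y' : set_type L := SigSub (mem_set Ly).
  move=> psixy.
  have psi_eq : psi (val x') <> psi (val y') by [].
  have [[U V] /= [/set_mem Ux /set_mem Vy] [oU oV /eqP UV]] :
      exists2 AB : set R * set R, (psi x \in AB.1 /\ psi y \in AB.2) &
        [/\ open AB.1, open AB.2 & AB.1 `&` AB.2 == set0].
    by have := @Rhausdorff R; rewrite open_hausdorff; apply; exact/eqP.
  have nb (z : set_type L) (B : set R) : open B -> B (psi (val z)) ->
      exists2 C, weight (set_type L) C /\ C z & C `<=` (psi \o @set_val E L) @^-1` B.
    move=> oB Bz; have [|C [wC Cz] CB] := wLb z ((psi \o @set_val E L) @^-1` B).
      by apply: (continuous_comp (cval z) (cpsi _)); exact: open_nbhs_nbhs.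
    by exists C.
  have [B [wB Bx'] BU] := nb x' U oU Ux.
  have [C [wC Cy'] CV] := nb y' V oV Vy.
  have [_ _ /(_ (B, C))] := phiP (e (B, C)).
  move=> /(_ (conj wB wC) erefl) sepBC.
  have {}sepBC : separates (B, C) (phi (e (B, C))).
    apply: sepBC; exists psi; split=> // a b /= /BU Ua /CV Vb ab.
    suff : (U `&` V) (psi (val a)) by rewrite UV.
    by split => //; rewrite ab.
  exact: (sepBC x' y' Bx' Cy' (exy _)).
move=> w C clC.
have /choice[pM pMP] : forall l : set_type L, exists m : set_type M, val m = p (val l).
  move=> l; case: ap => _ _ pLM; have Mpl : M (p (val l)).
    by rewrite -pLM; exists (val l) => //; exact: (set_valP l).
  by exists (SigSub (mem_set Mpl)).
have cpM : continuous pM.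
  apply: (@continuous_comp_initial _ _ _ (@set_val F M) pM).
  by rewrite (_ : _ \o _ = p \o @set_val E L)//; apply/funext => l; exact: pMP.
have hM : accessible_space (set_type M).
  exact/hausdorff_accessible/hausdorff_set_type.
pose half (jqb : set_type W * (rat * bool)) : set (set_type L) :=
  if jqb.2.2 then [set l | phi jqb.1 (val l) <= ratr jqb.2.1]
  else [set l | ratr jqb.2.1 <= phi jqb.1 (val l)].
(* Preimages of a small base of [M] and rational half-spaces of the coordinates before [w]: fewer
   than [A] closed sets, because initial segments are small. *)
pose G := (fun V => ~` (pM @^-1` V)) @` weight (set_type M) `|`
  half @` ([set v | lt v w] `*` [set: rat * bool]).
apply: (@lt_union_closed_separated _ _ G) => //.
- apply: card_lt_setU => //; first by apply: card_le_lt wM; exact: card_image_le.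
  apply: (card_le_lt (card_image_le _ _)); apply: card_lt_setX => //.
  by apply: card_lt_countable => //; exact: countableP.
- move=> _ [[V wV <-]|[[j [q b]] _ <-]].
    by apply: open_closedC; apply: open_comp; [move=> *; exact: cpM|exact: wMo wV].
  rewrite /half /=; case: b.
    apply: (@closed_comp _ _ (phi j \o @set_val E L) [set y | y <= ratr q]).
      by move=> *; exact: cphiv.
    exact: closed_le.
  apply: (@closed_comp _ _ (phi j \o @set_val E L) [set y | ratr q <= y]).
    by move=> *; exact: cphiv.
  exact: closed_ge.
- exact: same_coords_open.
(* As [l'] is equivalent to a point of [C] and [l] is not, the two differ in [M] or in a coordinate
   before [w]. *)
move=> l l' Wl /contrapT[c Cc [pc phic]].
have [pll'|pll'] := pselect (pM l = pM l'); last first.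
  have [U [oU /set_mem Ul' /set_mem Ul]] := hM (pM l') (pM l) (introN eqP (nesym pll')).
  have [B [wB Bl'] BU] := wMb (pM l') U (open_nbhs_nbhs (conj oU Ul')).
  exists (~` (pM @^-1` B)); first by left; exists B.
  by split=> [/= /BU//|]; exact.
have [j jw phill'] : exists2 j, lt j w & phi j (val l) <> phi j (val l').
  apply: contrapT => nj; apply: Wl; exists c => //; split.
    by rewrite -pc /= -[LHS]pMP pll' pMP.
  move=> j jw; rewrite -phic//; apply: contrapT => ?; apply: nj; by exists j.
have [lt_|gt_|/phill'//] := ltgtP (phi j (val l)) (phi j (val l')).
  have [q] := rat_in_itvoo lt_; rewrite in_itv /= => /andP[q1 q2].
  exists (half (j, (q, true))); first by right; exists (j, (q, true)).
  by split; rewrite /half /=; [exact: ltW|apply/negP; rewrite -ltNge].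
have [q] := rat_in_itvoo gt_; rewrite in_itv /= => /andP[q1 q2].
exists (half (j, (q, false))); first by right; exists (j, (q, false)).
by split; rewrite /half /=; [exact: ltW|apply/negP; rewrite -ltNge].
Qed.

(** * A compact convex set separating two open sets *)

(** A separate name on which the pointwise module structure and the product topology are combined
    into a locally convex space. *)
Definition real_product (R : realType) (I : Type) : Type := I -> R^o.

HB.instance Definition _ (R : realType) (I : Type) :=
  GRing.Lmodule.copy (real_product R I) (I -> R^o).
HB.instance Definition _ (R : realType) (I : Type) :=
  Topological.copy (real_product R I) (prod_topology (fun _ : I => R^o)).

Lemma real_product_cvg (R : realType) (I : Type) (T : Type) (G : set_system T)
    (g : T -> real_product R I) (l : real_product R I) :
  Filter G -> (forall i, (fun x => g x i) @ G --> l i) -> g @ G --> l.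
Proof.
move=> FG gl; apply/cvg_sup => i U [_ [[V oV <-] /= Vl] VU].
by apply: (filterS VU); apply: gl; exact: open_nbhs_nbhs.
Qed.

Lemma real_product_continuous (R : realType) (I : Type) (T : topologicalType)
    (g : T -> real_product R I) :
  (forall i, continuous (fun x => g x i)) -> continuous g.
Proof. by move=> cg x; apply: real_product_cvg => i; exact: cg. Qed.

Lemma real_product_proj (R : realType) (I : Type) (i : I) :
  continuous (fun l : real_product R I => l i).
Proof. exact: (@proj_continuous {classic I} (fun=> R^o) i). Qed.

Lemma real_product_add (R : realType) (I : Type) :
  continuous (fun x : real_product R I * real_product R I => x.1 + x.2).
Proof.
move=> x; apply: real_product_cvg => i.
apply: (@cvgD _ R^o).
  apply: (cvg_comp fst (fun l : real_product R I => l i)); first exact: cvg_fst.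
  exact: real_product_proj.
apply: (cvg_comp snd (fun l : real_product R I => l i)); first exact: cvg_snd.
  exact: real_product_proj.
Qed.

Lemma real_product_scale (R : realType) (I : Type) :
  continuous (fun z : R^o * real_product R I => z.1 *: z.2).
Proof.
move=> z; apply: real_product_cvg => i.
apply: (@cvgZ _ R^o); first exact: cvg_fst.
apply: (cvg_comp snd (fun l : real_product R I => l i)); first exact: cvg_snd.
  exact: real_product_proj.
Qed.

Lemma real_product_locally_convex (R : realType) (I : Type) :
  exists2 B : set_system (real_product R I),
    (forall b, b \in B -> convex_set b) & basis B.
Proof.
exists [set b | open b /\ @convex_set R (real_product R I) b].
  by move=> b /set_mem [].
split=> [b []//|l].
pose D := [set b | (open b /\ @convex_set R (real_product R I) b) /\ b l].
have FD : Filter (filter_from D id).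
  apply: filter_from_filter.
    by exists setT; split => //; split; [exact: openT|move=> *; exact: in_setT].
  move=> b c [[ob cb] bl] [[oc cc] cl]; exists (b `&` c) => //.
  split=> //; split; first exact: openI.
  move=> x y t; rewrite !in_setI => /andP[xb xc] /andP[yb yc].
  by rewrite cb// cc.
(* That open convex sets form a base at [l] means that the filter they generate converges to [l],
   which is checked on each coordinate with strips. *)
apply: (@real_product_cvg R I _ (filter_from D id) id l) => i U.
rewrite /= -nbhs_ballE => -[e e0 eU].
exists [set x : real_product R I | ball (l i) e (x i)]; last by move=> x /eU.
split; last exact: ballxx.
split.
  by apply: open_comp (@ball_open _ R^o (l i) e); move=> *; exact: real_product_proj.
apply/convex_setP => x y t; rewrite /ball /= !ltr_norml.
move=> /andP[x1 x2] /andP[y1 y2] /andP[t0 t1].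
have -> : l i - (t *: x + (1 - t) *: y) i = t * (l i - x i) + (1 - t) * (l i - y i).
  by rewrite -[(_ + _) i]/(t * x i + (1 - t) * y i); ring.
set a := l i - x i in x1 x2 *; set b := l i - y i in y1 y2 *.
(* One of the weights [t] and [1 - t] is at least a half, which keeps the inequality strict. *)
by apply/andP; split; have [t12|t12] := leP t (1 / 2); nra.
Qed.

HB.instance Definition _ (R : realType) (I : Type) :=
  PreTopologicalLmod_isTvs.Build R (real_product R I)
    (@real_product_add R I) (@real_product_scale R I)
    (@real_product_locally_convex R I).
HB.instance Definition _ (R : realType) (I : Type) :=
  PreTopologicalNmodule_isTopologicalNmodule.Build (real_product R I)
    (@real_product_add R I).
HB.instance Definition _ (R : realType) (I : Type) :=
  TopologicalNmodule_isTopologicalLmodule.Build R (real_product R I)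
    (@real_product_scale R I).
HB.instance Definition _ (R : realType) (I : Type) :=
  Uniform_isTvs.Build R (real_product R I) (@real_product_locally_convex R I).

(** Finite intersections of members of [G] form a base. If none through [l] lay in [W], the traces
    of their closures off [W] would share a point [l']; but disjoint members of [G] around [l] and
    [l'] keep [l'] out of one closure. *)
Lemma card_lt_weight_separated (A : Type) (X : topologicalType) (G : set (set X)) :
  card_lt [set: nat] [set: A] -> compact [set: X] -> card_lt G [set: A] ->
  G `<=` open ->
  (forall l l', l <> l' -> exists U V, [/\ G U, G V, U l, V l' & U `&` V = set0]) ->
  card_lt (weight X) [set: A].
Proof.
move=> Ainf cX Glt Go sepG; apply/weight_ltP.
pose cap (s : seq (set X)) := foldr setI setT s.
have cap_open s : allin G s -> open (cap s).
  elim: s => [_|B s IH /allin_cons[GB Gs]] /=; first exact: openT.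
  by apply: openI; [exact: Go|exact: IH].
exists (cap @` [set s | allin G s]); last first.
  by apply: (card_le_lt (card_image_le _ _)); exact: card_lt_seq.
split=> [_ [s Gs <-]|l U]; first exact: cap_open.
rewrite nbhsE => -[W [oW Wl] WU].
suff [s [Gs sl] sW] : exists2 s, allin [set B | G B /\ B l] s /\ cap s l & cap s `<=` W.
  exists (cap s); last exact: subset_trans WU.
  by split=> //; exists s => //; apply: sub_allin Gs => B [].
apply: contrapT => ns.
have capl s : allin [set B | G B /\ B l] s -> cap s l.
  by elim: s => // B s IH /allin_cons[[_ Bl] /IH].
have [|s t Gs Gt|s Gs|l' l'P] := @compact_bigcap_directed X _
    [set s | allin [set B | G B /\ B l] s] (fun s => closure (cap s) `&` ~` W) cX.
- by exists [::].
- exists (s ++ t); first exact/allin_cat.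
  have -> : cap (s ++ t) = cap s `&` cap t.
    by elim: s {Gs} => [|B s IH] /=; rewrite ?setTI// IH setIA.
  by move=> x [clx nWx]; split; split => //; apply: closureS clx => y [].
- split; first by apply: closedI; [exact: closed_closure|exact: open_closedC].
  apply: contrapT => nW; apply: ns; exists s; first by split => //; exact: capl.
  move=> x sx; apply: contrapT => Wx; apply: nW; exists x; split => //.
  exact: subset_closure.
have Wl' : ~ W l' by case: (l'P [::] isT).
have [|B [C [GB GC Bl Cl' BC]]] := sepG l l'; first by move=> e; rewrite -e in Wl'.
have [|clB _] := l'P [:: B]; first exact/allin_cons.
have [|x [[Bx _] Cx]] := clB C.
  by apply: open_nbhs_nbhs; split => //; exact: Go.
suff : (B `&` C) x by rewrite BC.
by [].
Qed.

(** Open half-spaces at rational levels in the coordinates of [J] separate the points of [L]. *)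
Lemma card_lt_weight_real_product (R : realType) (A I : Type)
    (L : set (real_product R I)) (J : set I) :
  card_lt [set: nat] [set: A] -> compact L -> card_lt J [set: A] ->
  (forall l l', L l -> L l' -> (forall i, J i -> l i = l' i) -> l = l') ->
  card_lt (weight (set_type L)) [set: A].
Proof.
move=> Ainf cL Jlt JL; have cX := compact_set_type cL.
pose half (jqb : I * (rat * bool)) : set (set_type L) :=
  if jqb.2.2 then [set l | val l jqb.1 < ratr jqb.2.1]
  else [set l | ratr jqb.2.1 < val l jqb.1].
have cproj i : continuous (fun l : set_type L => val l i).
  move=> l; apply: (@continuous_comp _ _ _ (val : set_type L -> real_product R I)
    (fun x : real_product R I => x i)); first exact: continuous_val.
  exact: real_product_proj.
apply: (@card_lt_weight_separated _ _ (half @` (J `*` [set: rat * bool]))) => //.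
- apply: (card_le_lt (card_image_le _ _)); apply: card_lt_setX => //.
  by apply: card_lt_countable => //; exact: countableP.
- move=> _ [[j [q b]] _ <-]; rewrite /half /=; case: b.
    apply: (@open_comp _ _ (fun l : set_type L => val l j) [set y | y < ratr q]).
      by move=> *; exact: cproj.
    exact: open_lt.
  apply: (@open_comp _ _ (fun l : set_type L => val l j) [set y | ratr q < y]).
    by move=> *; exact: cproj.
  exact: open_gt.
move=> l l' ll'.
have [j Jj /eqP jll'] : exists2 j, J j & val l j <> val l' j.
  apply: contrapT => nj; apply: ll'; apply: val_inj; apply: JL => [||j Jj].
  - exact: (set_valP l).
  - exact: (set_valP l').
  - by apply: contrapT => ?; apply: nj; exists j.
have half0 q : half (j, (q, true)) `&` half (j, (q, false)) = set0.
  by rewrite -subset0 => x [] /=; rewrite /half /= => /lt_trans /[apply]; rewrite ltxx.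
move: jll'; rewrite neq_lt => /orP[lt_|gt_].
  have [q] := rat_in_itvoo lt_; rewrite in_itv /= => /andP[q1 q2].
  exists (half (j, (q, true))), (half (j, (q, false))); split => //.
  - by exists (j, (q, true)).
  - by exists (j, (q, false)).
have [q] := rat_in_itvoo gt_; rewrite in_itv /= => /andP[q1 q2].
exists (half (j, (q, false))), (half (j, (q, true))); split => //.
- by exists (j, (q, false)).
- by exists (j, (q, true)).
- by rewrite setIC.
Qed.

(** The family is indexed by all subsets of [K], with the zero function outside [F], to match a
    product over all subsets. *)
Lemma urysohn_family (R : realType) (K : topologicalType) (U : set K)
    (F : set (set K)) :
  normal_space K -> open U -> (forall C, F C -> closed C) -> (forall C, F C -> C `<=` U) ->
  exists u : set K -> K -> R, [/\ forall C, continuous (u C),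
    forall C x, 0 <= u C x <= 1, forall C x, ~ U x -> u C x = 0,
    forall C x, ~ F C -> u C x = 0 & forall C x, F C -> C x -> u C x = 1].
Proof.
move=> nK oU Fcl FU.
have /choice[u uP] : forall C, exists u : K -> R, [/\ continuous u,
    forall x, 0 <= u x <= 1, forall x, ~ U x -> u x = 0,
    ~ F C -> forall x, u x = 0 & F C -> forall x, C x -> u x = 1].
  move=> C; have [FC|nFC] := pselect (F C); last first.
    by exists (fun=> 0); split=> // [|x]; [exact: cst_continuous|rewrite lexx ler01].
  have UC : ~` U `&` C = set0 by rewrite -subset0 => x [nUx /(FU _ FC)].
  have [+ _] := @normal_separatorP R K.
  move=> /(_ nK _ _ (open_closedC oU) (Fcl _ FC) UC).
  move=> /(@uniform_separatorP _ R)[u [cu u01 uU uC]].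
  exists u; split=> // [x|x Ux|_ x Cx].
  - by have := u01 (u x); rewrite /= in_itv /=; apply; exists x.
  - by apply: uU; exists x.
  - by apply: uC; exists x.
exists u; split => [C|C x|C x Ux|C x FC|C x FC Cx].
- by case: (uP C).
- by case: (uP C).
- by case: (uP C) => _ _ + _ _; exact.
- by case: (uP C) => _ _ _ + _; exact.
- by case: (uP C) => _ _ _ _; exact.
Qed.

(** Lifting is assumed only when both sets have weight below [A], a case contained in each of (2),
    (3) and (4). *)
Lemma F_space_of_lifting (R : realType) (A : Type) (K : topologicalType) :
  card_lt [set: nat] [set: A] -> compact [set: K] -> hausdorff_space K ->
  (forall (I : Type) (L M : set (real_product R I)) (p : real_product R I -> real_product R I),
    compact_convex L ->
    compact_convex M ->
    card_lt (weight (set_type L)) [set: A] ->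
    card_lt (weight (set_type M)) [set: A] ->
    affine_surjection L M p ->
    forall f : K -> real_product R I, continuous f -> range f `<=` M ->
    exists g : K -> real_product R I,
      [/\ continuous g, range g `<=` L & p \o g = f]) ->
  F_space A K.
Proof.
move=> Ainf cK hK lift; split=> // U V oU oV UV [F1 F1lt [F1cl UE]] [F2 F2lt [F2cl VE]].
have nK : normal_space K by exact: compact_normal.
have F1U C : F1 C -> C `<=` U by move=> FC x Cx; rewrite UE; exists C.
have F2V C : F2 C -> C `<=` V by move=> FC x Cx; rewrite VE; exists C.
have [u [cu u01 uU uF uC]] := @urysohn_family R K U F1 nK oU F1cl F1U.
have [v [cv v01 vV vF vC]] := @urysohn_family R K V F2 nK oV F2cl F2V.
(* [None] indexes the coordinate [r], the two summands index the [s_C] and the [t_D]; [J] marks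
   [None] and the members of [F1] and [F2]. *)
pose idx := option (set K + set K).
pose E := real_product R idx.
pose J : set idx := [set None] `|` ((Some \o inl) @` F1 `|` (Some \o inr) @` F2).
have Jlt : card_lt J [set: A].
  apply: card_lt_setU => //; first by apply: card_lt_countable => //; exact: countable1.
  by apply: card_lt_setU => //; [apply: card_le_lt F1lt|apply: card_le_lt F2lt];
    exact: card_image_le.
(* Vanishing off [J] makes the points of [L] depend on fewer than [A] coordinates, which bounds the
   weight. *)
pose L : set E := [set l | [/\ forall i, 0 <= l i <= 1,
  forall C, l (Some (inl C)) <= l None, forall C, l (Some (inr C)) <= 1 - l None &
  forall i, ~ J i -> l i = 0]].
(* Forgetting [r] is done by overwriting it with [0], within the same space. *)
pose p (l : E) : E := fun i => if i is None then 0 else l i.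
pose f x : E := fun i => match i with None => 0 | Some (inl C) => u C x
                                   | Some (inr C) => v C x end.
have cproj i : continuous (fun l : E => l i) by exact: real_product_proj.
have hE : hausdorff_space E.
  move=> l l' ll'; apply/funext => i; apply: (@Rhausdorff R) => D D' Dl D'l'.
  have [||m [Dm D'm]] := ll' [set l | D (l i)] [set l | D' (l i)].
  - exact: cproj Dl.
  - exact: cproj D'l'.
  - by exists (m i).
have cL : compact L.
  have ccube : compact [set l : E | forall i, `[0, 1]%classic (l i)].
    exact: (@tychonoff {classic idx} (fun=> R^o) (fun=> `[0, 1]%classic)
      (fun=> @segment_compact R 0 1)).
  apply: subclosed_compact ccube _; last first.
    by move=> l [l01 _ _ _] i; rewrite /= in_itv /=.
  rewrite (_ : L = \bigcap_(i in setT) [set l : E | 0 <= l i] `&`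
    \bigcap_(i in setT) [set l : E | l i <= 1] `&`
    \bigcap_(C in setT) [set l : E | l (Some (inl C)) - l None <= 0] `&`
    \bigcap_(C in setT) [set l : E | l (Some (inr C)) + l None <= 1] `&`
    \bigcap_(i in ~` J) [set l : E | l i = 0]); last first.
    apply/seteqP; split=> l.
      move=> [l01 lU lV lJ]; split; last exact: lJ.
      split; last by move=> C _ /=; have := lV C; lra.
      split; last by move=> C _ /=; have := lU C; lra.
      by split=> i _ /=; case/andP: (l01 i).
    move=> [[[[l0 l1] lU] lV] lJ]; split=> // [i|C|C].
    - by apply/andP; split; [exact: l0|exact: l1].
    - by have /= := lU C I; lra.
    - by have /= := lV C I; lra.
  have cl1 (h : E -> R) (D : set R) : continuous h -> closed D -> closed (h @^-1` D).
    by move=> ch clD; apply: (@closed_comp _ _ h D) => // *; exact: ch.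
  do 4?[apply: closedI]; apply: closed_bigI => i _.
  - by apply: (cl1 _ [set y | 0 <= y] (cproj i)); exact: closed_ge.
  - by apply: (cl1 _ [set y | y <= 1] (cproj i)); exact: closed_le.
  - apply: (cl1 (fun l => l (Some (inl i)) - l None) [set y | y <= 0]); last exact: closed_le.
    by move=> l; exact: (cvgB (cproj (Some (inl i)) l) (cproj None l)).
  - apply: (cl1 (fun l => l (Some (inr i)) + l None) [set y | y <= 1]); last exact: closed_le.
    by move=> l; exact: (cvgD (cproj (Some (inr i)) l) (cproj None l)).
  - by apply: (cl1 _ [set y | y = 0] (cproj i)); exact: closed_eq.
have cvL : convex_set L.
  apply/convex_setP => l l' t [l01 lU lV lJ] [l'01 l'U l'V l'J] /andP[t0 t1].
  have tE i : (t *: l + (1 - t) *: l') i = t * l i + (1 - t) * l' i by [].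
  split=> [i|C|C|i Ji]; rewrite !tE.
  - by move: (l01 i) (l'01 i) => /andP[? ?] /andP[? ?]; apply/andP; split; nra.
  - by have := lU C; have := l'U C; nra.
  - by have := lV C; have := l'V C; nra.
  - by rewrite lJ// l'J// !mulr0 addr0.
have cp : continuous p.
  by apply: real_product_continuous => -[i|]; [exact: cproj|exact: cst_continuous].
have affp : affine_on L p.
  move=> l l' t Ll Ll'; apply/funext => -[i|] //=.
  by rewrite -[RHS]/(t%:num * 0 + (1 - t%:num) * 0) !mulr0 addr0.
have ccL : compact_convex L by [].
have ccM : compact_convex (p @` L).
  split=> //; first by apply: continuous_compact cL; exact: continuous_subspaceT.
  apply/convex_setP => _ _ t [l Ll <-] [l' Ll' <-] /andP[t0 t1].
  exists (t *: l + (1 - t) *: l').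
    by apply: ((convex_setP L).1 cvL) => //; exact/andP.
  have := affp l l' (Itv01 t0 t1) Ll Ll'; exact.
have wL : card_lt (weight (set_type L)) [set: A].
  apply: (card_lt_weight_real_product Ainf cL Jlt) => l l' [_ _ _ lJ] [_ _ _ l'J] e.
  apply/funext => i; have [Ji|nJi] := pselect (J i); first exact: e.
  by rewrite lJ// l'J.
have wM : card_lt (weight (set_type (p @` L))) [set: A].
  have [_ cM _] := ccM.
  apply: (card_lt_weight_real_product Ainf cM Jlt).
  move=> _ _ [l [_ _ _ lJ] <-] [l' [_ _ _ l'J] <-] e.
  apply/funext => i; have [Ji|nJi] := pselect (J i); first exact: e.
  by case: i nJi => [i|] nJi //=; rewrite lJ// l'J.
have cf : continuous f.
  by apply: real_product_continuous => -[[C|C]|];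
    [exact: cu|exact: cv|exact: cst_continuous].
have fM : range f `<=` p @` L.
  move=> _ [x _ <-].
  (* The indicator of [U] is a legitimate [r] at each point: every [u C] vanishes off [U], and every
     [v C] vanishes on [U], which is disjoint from [V]. A continuous choice of [r] comes only from
     the lift. *)
  exists (fun i => if i is None then if `[<U x>] then 1 else 0 else f x i); last first.
    by apply/funext => -[].
  split=> [[[C|C]|]|C|C|[[C|C]|] nJ] //=.
  - by case: asboolP; rewrite lexx ler01.
  - case: asboolP => Ux; first by case/andP: (u01 C x).
    by rewrite uU.
  - case: asboolP => Ux; last by rewrite subr0; case/andP: (v01 C x).
    by rewrite vV ?subrr// => Vx; suff : (U `&` V) x by rewrite UV.
  - by apply: uF => FC; apply: nJ; right; left; exists C.
  - by apply: vF => FC; apply: nJ; right; right; exists C.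
  - by case: nJ; left.
have ap : affine_surjection L (p @` L) p by split => //; exact: continuous_subspaceT.
have [g [cg gL pgf]] := lift idx L (p @` L) p ccL ccM wL wM ap f cf fM.
have gLx x : L (g x) by apply: gL; exists x.
have pgfx x i : p (g x) i = f x i by rewrite -pgf.
pose h x : R := g x None.
have ch : continuous h 
  by move=> x; apply: (@continuous_comp _ _ _ g (fun l : E => l None)); [exact: cg|exact: cproj].
(* On a member [C] of [F1] the constraint of [L] reads [1 = u C x <= h x], and this closed condition
   passes to the closure of [U]. *)
have hU : closure U `<=` [set x | 1 <= h x].
  have clh : closed [set x | 1 <= h x].
    by apply: (@closed_comp _ _ h [set y | 1 <= y]); [move=> *; exact: ch|exact: closed_ge].
  apply: subset_trans clh; apply: closureS; rewrite UE => x [C FC Cx] /=.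
  have [_ /(_ C) + _ _] := gLx x.
  by have /= := pgfx x (Some (inl C)); rewrite uC// => ->.
have hV : closure V `<=` [set x | h x <= 0].
  have clh : closed [set x | h x <= 0].
    by apply: (@closed_comp _ _ h [set y | y <= 0]); [move=> *; exact: ch|exact: closed_le].
  apply: subset_trans clh; apply: closureS; rewrite VE => x [C FC Cx] /=.
  have [_ _ /(_ C) + _] := gLx x.
  by have /= := pgfx x (Some (inr C)); rewrite vC// => ->; rewrite lerBrDr gerDl.
by rewrite -subset0 => x [/hU/= h1 /hV/= /(le_trans h1)]; rewrite ler10.
Qed.

(** * Equivalence of the four conditions *)

Theorem theorem6p10 (R : realType) (A : Type)
    (hA : card_lt [set: nat] [set: A])
    (K : topologicalType) (hKc : compact [set: K]) (hKh : hausdorff_space K) :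
  [<-> F_space A K;
       lifts_through K (fun (E F : tvsType R) (L : set E) (M : set F) =>
         card_lt (weight (set_type L)) [set: A]);
       lifts_through K (fun (E F : tvsType R) (L : set E) (M : set F) =>
         card_lt (weight (set_type M)) [set: A] /\
         weight (set_type L) #<= [set: A]);
       lifts_through K (fun (E F : tvsType R) (L : set E) (M : set F) =>
         HL_space A (set_type L))].
Proof.
have HLw (E : tvsType R) (L : set E) : compact_convex L ->
    card_lt (weight (set_type L)) [set: A] -> HL_space A (set_type L).
  move=> [hE cL _] wL; apply: accessible_HL_space => //; first exact: compact_set_type.
  exact/hausdorff_accessible/hausdorff_set_type.
have F_of2 : lifts_through K (fun (E F : tvsType R) (L : set E) (M : set F) =>
    card_lt (weight (set_type L)) [set: A]) -> F_space A K.
  move=> lift; apply: (@F_space_of_lifting R) => // I L M p ccL ccM wL wM.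
  exact: (lift _ _ L M).
have F_of3 : lifts_through K (fun (E F : tvsType R) (L : set E) (M : set F) =>
    card_lt (weight (set_type M)) [set: A] /\ weight (set_type L) #<= [set: A]) ->
    F_space A K.
  move=> lift; apply: (@F_space_of_lifting R) => // I L M p ccL ccM wL wM.
  by apply: (lift _ _ L M) => //; split => //; case: wL.
have F_of4 : lifts_through K (fun (E F : tvsType R) (L : set E) (M : set F) =>
    HL_space A (set_type L)) -> F_space A K.
  move=> lift; apply: (@F_space_of_lifting R) => // I L M p ccL ccM wL wM.
  by apply: (lift _ _ L M) => //; exact: HLw.
(* In the cycle, the steps from (2) to (3) and from (3) to (4) first return to (1). *)
tfae.
- move=> FK E F L M ccL ccM wL p ap f cf fM.
  exact: (HL_lifts FK hKh ccL ccM (HLw _ _ ccL wL) ap cf fM).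
- move=> /F_of2 FK E F L M ccL ccM [wM wL] p ap f cf fM.
  exact: (weight_lifts hA FK hKh ccL ccM wM wL ap cf fM).
- move=> /F_of3 FK E F L M ccL ccM HL p ap f cf fM.
  exact: (HL_lifts FK hKh ccL ccM HL ap cf fM).
- exact: F_of4.
Qed.
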